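(* For all integers $s\geq 1$, $$\widehat{\alpha}(s) \geq \lfloor \sqrt{2s-1} \rfloor,$$ where $\widehat{\alpha}(s)$ denotes the Waldschmidt constant of the ideal of $s$ very general lines in $\mathbb{P}^3$.
   Context: Let $\mathbb{K}$ be an uncountable algebraically closed field of characteristic $0$ and $R=\mathbb{K}[x_0,\dots,x_3]$. For a homogeneous ideal $I\subset R$, the $m$-th symbolic power is $I^{(m)}=R\cap\bigcap_{P\in\mathrm{Ass}(I)}I^mR_P$ (intersection taken in the fraction field of $R$). The initial degree of a nonzero homogeneous ideal $I$ is $\alpha(I)=\min\{t: (I)_t\neq 0\}$, where $(I)_t$ is the degree $t$ part of $I$. The Waldschmidt constant of $I$ is $\widehat{\alpha}(I)=\lim_{m\to\infty}\alpha(I^{(m)})/m$ (the limit exists). ''Very general'' means: outside a countable union of proper Zariski closed subsets of the parameter space (here the product of $s$ copies of the Grassmannian of lines in $\mathbb{P}^3$). For an integer $s\ge 1$, $\widehat{\alpha}(s)$ denotes the Waldschmidt constant of the radical ideal of the union of $s$ very general lines in $\mathbb{P}^3$. *)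

(* Defs.v *)
From HB Require Import structures.
(* mpoly has to precede the classical/analysis libraries: in the opposite order
   the notation levels of the two clash. *)
From mathcomp Require Import all_boot all_order all_algebra.
From mathcomp Require Import mpoly.
From mathcomp Require Import all_classical all_reals.
From mathcomp Require Import topology normedtype sequences.

Set Implicit Arguments.
Unset Strict Implicit.
Unset Printing Implicit Defensive.

Import Order.TTheory GRing.Theory Num.Theory.
Import numFieldNormedType.Exports.

Local Open Scope classical_set_scope.
Local Open Scope ring_scope.

Section SymbolicPowers.
Variable A : idomainType.
Implicit Types (S I J P : set A).

Definition ideal_gen S : set A :=
  [set f | exists n, exists r g : 'I_n -> A,
     (forall i, S (g i)) /\ f = \sum_(i < n) r i * g i].

(* For m = 0 the only generator is the empty product 1, so I^0 = A. *)
Definition ideal_pow I (m : nat) : set A :=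
  ideal_gen [set f | exists g : 'I_m -> A,
     (forall i, I (g i)) /\ f = \prod_(i < m) g i].

(* [idealr_closed] already includes properness (1 is not in P). *)
Definition prime_ideal P : Prop :=
  idealr_closed (mem P) /\ prime_idealr_closed (mem P).

(* Ass(I) = Ass(A/I): the primes that are the annihilator (I : f) of the class
   of some f. *)
Definition associated_primes I : set (set A) :=
  [set P | prime_ideal P /\ exists f, P = [set g | I (g * f)]].

(* J A_P, as a subset of the fraction field. *)
Definition localized J P : set {fraction A} :=
  [set x | exists a g, [/\ J a, ~ P g & x = tofrac a / tofrac g]].

Definition symbolic_power I (m : nat) : set A :=
  [set f | forall P, associated_primes I P ->
     localized (ideal_pow I m) P (tofrac f)].

End SymbolicPowers.

(* The least degree of a nonzero homogeneous element; 0 by convention when there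
   is no such element, i.e. for the zero ideal. *)
Definition initial_degree (K : fieldType) (n : nat) (I : set {mpoly K[n]}) : nat :=
  let degrees := [set t | exists f, [/\ I f, f != 0 & f \is t.-homog]] in
  xget 0%N [set t | degrees t /\ forall u, degrees u -> (t <= u)%N].

Definition waldschmidt (K : fieldType) (R : realType) (n : nat)
    (I : set {mpoly K[n]}) : R :=
  limn (fun m => (initial_degree (symbolic_power I m))%:R / m%:R : R).

Section Lines.
Variable K : fieldType.

(* Lines of P^3 are the planes of K^4. *)
Definition line := {V : {vspace 'rV[K]_4} | \dim V == 2%N}.

(* The ideal of the union of the lines, given as the ideal of the polynomials
   vanishing on the affine cone of the union; over an infinite field this is a
   homogeneous ideal, and it is radical. *)
Definition lines_ideal (s : nat) (L : 'I_s -> line) : set {mpoly K[4]} :=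
  [set f | forall (k : 'I_s) (v : 'rV[K]_4), v \in val (L k) ->
     f.@[fun i => v 0 i] = 0].

Definition plucker_pair (j : 'I_6) : 'I_4 * 'I_4 :=
  nth (inord 0, inord 0)
    [:: (inord 0, inord 1); (inord 0, inord 2); (inord 0, inord 3);
        (inord 1, inord 2); (inord 1, inord 3); (inord 2, inord 3)] j.

(* A representative of the point of P^5; another basis would rescale it. *)
Definition plucker (l : line) : 'rV[K]_6 :=
  let b := vbasis (val l) in
  \row_j (let: (p, q) := plucker_pair j in
          b`_0 0 p * b`_1 0 q - b`_0 0 q * b`_1 0 p).

(* Polynomials in the coordinates of (P^5)^s: the variable of index
   [mxvec_index k j] is the j-th coordinate of the k-th factor. *)
Definition multihomogeneous (s : nat) (f : {mpoly K[s * 6]}) : Prop :=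
  exists d : 'I_s -> nat, forall m, m \in msupp f ->
    forall k, (\sum_(j < 6) m (mxvec_index k j))%N = d k.

Definition plucker_eval (s : nat) (f : {mpoly K[s * 6]}) (L : 'I_s -> line) : K :=
  f.@[fun i => mxvec (\matrix_(k < s, j < 6) plucker (L k) 0 j) 0 i].

(* Zariski topology of the product of s Grassmannians, embedded in (P^5)^s. *)
Definition zariski_closed (s : nat) (Z : set ('I_s -> line)) : Prop :=
  exists F : set {mpoly K[s * 6]},
    (forall f, F f -> multihomogeneous f) /\
    Z = [set L | forall f, F f -> plucker_eval f L = 0].

Definition very_general (s : nat) (Q : ('I_s -> line) -> Prop) : Prop :=
  exists Z : nat -> set ('I_s -> line),
    (forall n, zariski_closed (Z n) /\ Z n <> setT) /\
    forall L, ~ (\bigcup_n Z n) L -> Q L.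

(* The common value of the Waldschmidt constants of s very general lines; it is
   unique when the field is algebraically closed and uncountable, as then no
   countable union of proper closed subsets covers the product of Grassmannians.
   The default 0 would only be returned if there were no common value. *)
Definition alpha_hat (R : realType) (s : nat) : R :=
  xget 0 [set a | very_general (fun L : 'I_s -> line =>
                    waldschmidt R (lines_ideal L) = a)].

End Lines.

(* Main.v *)
(** Specialize the s lines to transversals of the skew lines x = w = 0 and
    y = z = 0: for t in K let L_t be spanned by (1, t^n, 0, 0) and (0, 0, 1, t),
    where n + 1 = k = floor (sqrt (2 s - 1)) and t^(n^2 + 1) = 1.  A form of degree d
    vanishing to order m along such lines splits into components of bidegrees
    (a, b) with a + b = d, each giving a curve D on P^1 x P^1 with multiplicity
    >= m at the points (t^n, t).  These points lie on the curves X = Y^n and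
    X^n Y = 1, which are smooth, irreducible, and of bidegrees (1, n) and (n, 1).
    If D contains one of them, remove it: a + b drops by k and m by at most 1.
    Otherwise Bezout gives n a + b >= s' m and a + n b >= s' m, where
    s' = min (s, n^2 + 1) is the number of distinct points, and 2 s' >= k^2.
    Either way d >= k m.

    Having a form of given degree and order of vanishing is a closed condition on
    the lines, expressed by minors in the Pluecker coordinates.  Hence, outside
    countably many proper closed sets, each initial degree takes its maximal
    value, which is at least k m; the limit exists by subadditivity. *)

From HB Require Import structures.
Require Import Defs.
From mathcomp Require Import all_boot all_order all_algebra.
From mathcomp Require Import mpoly.
From mathcomp Require Import all_classical all_reals.
From mathcomp Require Import topology normedtype sequences.
From mathcomp Require Import separable cyclotomic.
From mathcomp Require Import ring lra zify.

Set Implicit Arguments.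
Unset Strict Implicit.
Unset Printing Implicit Defensive.

Import Order.TTheory GRing.Theory Num.Theory.
Import numFieldNormedType.Exports.
Local Open Scope classical_set_scope.
Local Open Scope ring_scope.

(** * Divisibility by powers, powers of ideals *)

Section PowerDivisibility.
Variable S : comNzRingType.
Implicit Types (t x y : S) (m n : nat).

(** The t-adic order of x is at least m. Orders of vanishing below all take this form. *)
Definition pow_dvd t m x := exists r, x = r * t ^+ m.

Lemma pow_dvd0 t m : pow_dvd t m 0.
Proof. by exists 0; rewrite mul0r. Qed.

Lemma pow_dvdn0 t x : pow_dvd t 0 x.
Proof. by exists x; rewrite expr0 mulr1. Qed.

Lemma pow_dvdD t m x y : pow_dvd t m x -> pow_dvd t m y -> pow_dvd t m (x + y).
Proof. by move=> [r ->] [s ->]; exists (r + s); rewrite mulrDl. Qed.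

Lemma pow_dvd_mull t m x y : pow_dvd t m y -> pow_dvd t m (x * y).
Proof. by move=> [s ->]; exists (x * s); rewrite mulrA. Qed.

Lemma pow_dvdM t m n x y :
  pow_dvd t m x -> pow_dvd t n y -> pow_dvd t (m + n) (x * y).
Proof. by move=> [r ->] [s ->]; exists (r * s); rewrite exprD mulrACA. Qed.

Lemma pow_dvd_sum t m (I : Type) (r : seq I) (P : pred I) (F : I -> S) :
  (forall i, P i -> pow_dvd t m (F i)) -> pow_dvd t m (\sum_(i <- r | P i) F i).
Proof.
move=> H; elim/big_rec: _ => [|i x Pi Hx]; first exact: pow_dvd0.
by apply: pow_dvdD => //; apply: H.
Qed.

Lemma pow_dvd_prod t m (F : 'I_m -> S) :
  (forall i, pow_dvd t 1 (F i)) -> pow_dvd t m (\prod_(i < m) F i).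
Proof.
elim: m F => [|m IH] F H; first by rewrite big_ord0; apply: pow_dvdn0.
by rewrite big_ord_recl; apply: (@pow_dvdM t 1 m) => //; apply: IH.
Qed.

End PowerDivisibility.

Lemma pow_dvd_morph (S S' : comNzRingType) (g : {rmorphism S -> S'}) t m x :
  pow_dvd t m x -> pow_dvd (g t) m (g x).
Proof. by move=> [r ->]; exists (g r); rewrite rmorphM rmorphXn. Qed.

Lemma pow_dvdXP (S : comNzRingType) m (p : {poly S}) :
  pow_dvd 'X m p <-> forall j, (j < m)%N -> p`_j = 0.
Proof.
split=> [[r ->] j lt_jm|H]; first by rewrite coefMXn lt_jm.
exists (drop_poly m p); rewrite -[LHS](poly_take_drop m).
suff -> : take_poly m p = 0 by rewrite add0r.
by apply/polyP=> i; rewrite coef_take_poly coef0; case: ifP => // /H.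
Qed.

(** As u has nonzero constant term, h has order exactly n. Over a domain the coefficients of f below
    degree m then vanish one after the other, each being multiplied by the constant term of u in the
    product f u. *)
Lemma pow_dvdX_cancel (R : idomainType) m n (u h f : {poly R}) :
  h = u * 'X^n -> u`_0 != 0 ->
  pow_dvd 'X (m + n) (f * h) -> pow_dvd 'X m f.
Proof.
move=> -> u0 [r]; rewrite exprD !mulrA => /(mulIf (monic_neq0 (monicXn _ n))) E.
have /pow_dvdXP {r E} H : pow_dvd 'X m (f * u) by exists r.
apply/pow_dvdXP; elim/ltn_ind=> j IH lt_jm.
have := H j lt_jm; rewrite coefM big_ord_recr /= subnn big1 => [|i _].
  by rewrite add0r => /eqP; rewrite mulf_eq0 (negPf u0) orbF => /eqP.
by rewrite IH ?mul0r // (ltn_trans (ltn_ord i)).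
Qed.

Section IdealPowers.
Variable A : idomainType.
Implicit Types (S I : set A) (f g : A) (m n : nat).

Lemma ideal_genD S f g : ideal_gen S f -> ideal_gen S g -> ideal_gen S (f + g).
Proof.
move=> [m [r [a [Ha ->]]]] [n [s [b [Hb ->]]]].
exists (m + n)%N, (fun i => match fintype.split i with inl j => r j | inr j => s j end),
  (fun i => match fintype.split i with inl j => a j | inr j => b j end); split.
  by move=> i; case: fintype.split => j; [apply: Ha|apply: Hb].
rewrite big_split_ord; congr (_ + _); apply: eq_bigr => i _.
  by rewrite (unsplitK (inl i)).
by rewrite (unsplitK (inr i)).
Qed.

Lemma ideal_gen0 S : ideal_gen S 0.
Proof. by exists 0%N, (fun=> 0), (fun=> 0); split=> [[]//|]; rewrite big_ord0. Qed.

Lemma ideal_genM S f g : ideal_gen S g -> ideal_gen S (f * g).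
Proof.
move=> [m [r [a [Ha ->]]]]; exists m, (fun i => f * r i), a; split=> //.
by rewrite mulr_sumr; apply: eq_bigr => i _; rewrite mulrA.
Qed.

Lemma ideal_gen_mem S g : S g -> ideal_gen S g.
Proof.
move=> Sg; exists 1%N, (fun=> 1), (fun=> g); split=> //.
by rewrite big_ord1 mul1r.
Qed.

Lemma ideal_gen_sum S (I : Type) (r : seq I) (P : pred I) (F : I -> A) :
  (forall i, P i -> ideal_gen S (F i)) -> ideal_gen S (\sum_(i <- r | P i) F i).
Proof.
move=> H; elim/big_rec: _ => [|i x Pi Hx]; first exact: ideal_gen0.
by apply: ideal_genD => //; apply: H.
Qed.

Lemma ideal_powM I m n f g :
  ideal_pow I m f -> ideal_pow I n g -> ideal_pow I (m + n) (f * g).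
Proof.
move=> [k [r [a [Ha ->]]]] [l [s [b [Hb ->]]]].
rewrite mulr_suml; apply: ideal_gen_sum => i _.
rewrite mulr_sumr; apply: ideal_gen_sum => j _.
rewrite mulrACA; apply: ideal_genM; apply: ideal_gen_mem.
have [c [Hc ->]] := Ha i; have [d [Hd ->]] := Hb j.
exists (fun i => match fintype.split i with inl j => c j | inr j => d j end); split.
  by move=> x; case: fintype.split => y; [apply: Hc|apply: Hd].
rewrite big_split_ord; congr (_ * _); apply: eq_bigr => x _.
  by rewrite (unsplitK (inl x)).
by rewrite (unsplitK (inr x)).
Qed.

Lemma ideal_pow0 I f : ideal_pow I 0 f.
Proof.
rewrite -[f]mulr1; apply: ideal_genM; apply: ideal_gen_mem.
by exists (fun=> 0); split=> [[]//|]; rewrite big_ord0.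
Qed.

Lemma ideal_powX I m f : I f -> ideal_pow I m (f ^+ m).
Proof.
move=> If; apply: ideal_gen_mem; exists (fun=> f); split=> //.
by rewrite prodr_const card_ord.
Qed.

Lemma ideal_pow_dvd (B : comNzRingType) (g : {rmorphism A -> B}) (t : B) I m f :
  (forall h, I h -> pow_dvd t 1 (g h)) ->
  ideal_pow I m f -> pow_dvd t m (g f).
Proof.
move=> H [k [r [a [Ha ->]]]]; rewrite rmorph_sum.
apply: pow_dvd_sum => i _; rewrite rmorphM; apply: pow_dvd_mull.
have [c [Hc ->]] := Ha i; rewrite rmorph_prod.
by apply: pow_dvd_prod => j; apply: H.
Qed.

End IdealPowers.

Lemma rmorph_mmap (n : nat) (R : nzRingType) (S S' : comNzRingType)
    (g : {rmorphism S -> S'}) (f : R -> S) (h : 'I_n -> S) (p : {mpoly R[n]}) :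
  g (mmap f h p) = mmap (g \o f) (g \o h) p.
Proof.
rewrite /mmap rmorph_sum; apply: eq_bigr => m _; rewrite rmorphM; congr (_ * _).
by rewrite /mmap1 rmorph_prod; apply: eq_bigr => i _; rewrite rmorphXn.
Qed.

Lemma eq_mmap (n : nat) (R S : nzRingType) (f f' : R -> S) (h h' : 'I_n -> S) :
  f =1 f' -> h =1 h' -> mmap f h =1 mmap f' h'.
Proof.
move=> Ef Eh p; rewrite /mmap; apply: eq_bigr => m _; rewrite Ef.
by congr (_ * _); apply: mmap1_eq.
Qed.

(** * Nonvanishing of polynomials at points in characteristic 0 *)

Section NonVanishing.
Variable K : idomainType.
Hypothesis charK : [pchar K] =i pred0.

Lemma natr_inj_char0 : injective (fun n : nat => n%:R : K).
Proof.
suff H i j : (i%:R : K) = (i + j)%:R -> j = 0%N.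
  move=> i j /= E; case: (leqP i j) => [le_ij|/ltnW le_ji].
    by rewrite -(subnKC le_ij) in E *; rewrite (H _ _ E) addn0.
  by rewrite -(subnKC le_ji) in E *; rewrite (H _ _ (esym E)) addn0.
rewrite natrD -[LHS]addr0 => /addrI/esym/eqP.
by have -> := (pcharf0P K).1 charK j; move=> /eqP.
Qed.

(** In characteristic 0 the images of 0, ..., size p - 1 are distinct, too many to be all roots of
    p. *)
Lemma poly_nonroot (p : {poly K}) : p != 0 -> exists c, p.[c] != 0.
Proof.
move=> p0; apply: contrapT => H.
pose s := [seq (i%:R : K) | i <- iota 0 (size p)].
have : (size s < size p)%N.
  apply: max_poly_roots => //.
    apply/allP=> _ /mapP[i _ ->]; apply/eqP; apply: contrapT => E.
    by apply: H; exists i%:R; apply/eqP.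
  by rewrite map_inj_uniq ?iota_uniq //; apply: natr_inj_char0.
by rewrite size_map size_iota ltnn.
Qed.

(** Every coefficient of p can be read off [muni p], which makes the last variable the outer one;
    hence [muni] is injective. *)
Lemma coef_muni n (p : {mpoly K[n.+1]}) (m : 'X_{1..n.+1}) :
  ((muni p)`_(m ord_max))@_[multinom m (widen_ord (leqnSn n) i) | i < n] = p@_m.
Proof.
rewrite muniE coef_sum raddf_sum /=.
rewrite [in RHS](mpolyE p) raddf_sum /=; apply: eq_bigr => i _.
rewrite coefZ coefXn mcoeffZ mcoeffX.
case: (altP (m ord_max =P i ord_max)) => [E1|N1]; last first.
  by rewrite mulr0 mcoeff0; case: (eqVneq i m) N1 => [->|_ _]; rewrite ?eqxx ?mulr0.
rewrite mulr1 mcoeffZ mcoeffX; congr (_ * (_)%:R); congr nat_of_bool.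
apply/eqP/eqP => [/mnmP E2|->//]; apply/mnmP => j.
case: (unliftP ord_max j) => [j' ->|->] //; have := E2 j'; rewrite !mnmE.
suff -> : widen_ord (leqnSn n) j' = lift ord_max j' by [].
by apply/val_inj; rewrite /= /bump leqNgt ltn_ord.
Qed.

Lemma mpoly_nonroot n (p : {mpoly K[n]}) : p != 0 -> exists v, p.@[v] != 0.
Proof.
elim: n p => [|n IH] p p0.
  exists (fun=> 0); move: p0; rewrite [p]nvar0_mpolyC mevalC.
  by rewrite mpolyC_eq0.
have : muni p != 0.
  apply: contra_neq p0 => E; apply/mpolyP => m.
  by rewrite -coef_muni E coef0 !mcoeff0.
(* Fix the first n variables at a point where the leading coefficient in the last one survives, then
   choose the last. *)
rewrite -lead_coef_eq0 => /IH [v Hv].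
have : map_poly (meval v) (muni p) != 0.
  apply: contra_neq Hv => /(congr1 (fun q : {poly K} => q`_(size (muni p)).-1)).
  by rewrite coef_map coef0.
move=> /poly_nonroot [c Hc].
exists (fun i => match fintype.split (cast_ord (esym (addn1 n)) i) with
                 | inl j => v j | inr _ => c end).
move: Hc; congr (_ != 0); rewrite /muni /meval.
rewrite -[LHS]/((horner_eval c \o map_poly (meval v)) _) rmorph_mmap.
apply: eq_mmap => [x|i] /=.
  by rewrite map_polyC /= /horner_eval hornerC mevalC.
case: (fintype.split _) => j /=; rewrite /horner_eval ?map_polyC ?map_polyX ?hornerC ?hornerX //=.
by rewrite mevalXU.
Qed.

Lemma mpoly_eq0_eval n (p : {mpoly K[n]}) : (forall v, p.@[v] = 0) -> p = 0.
Proof.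
by move=> H; apply/eqP; apply: contrapT => /negP/mpoly_nonroot[v]; rewrite H eqxx.
Qed.

End NonVanishing.

Lemma ideal_pow_le (A : idomainType) (I : set A) m n f :
  (m <= n)%N -> ideal_pow I n f -> ideal_pow I m f.
Proof.
move=> /subnKC <- [k [r [a [Ha ->]]]]; apply: ideal_gen_sum => i _.
apply: ideal_genM; have [c [Hc ->]] := Ha i.
rewrite big_split_ord /= mulrC; apply: ideal_genM; apply: ideal_gen_mem.
by exists (fun i => c (lshift _ i)).
Qed.

Lemma ideal_pow_prod (A : idomainType) (I : set A) (J : Type) (r : seq J)
    (P : pred J) (e : J -> nat) (F : J -> A) :
  (forall j, P j -> I (F j)) ->
  ideal_pow I (\sum_(j <- r | P j) e j) (\prod_(j <- r | P j) F j ^+ e j).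
Proof.
move=> H; elim/big_rec2: _ => [|j x m Pj Hx]; first exact: ideal_pow0.
by apply: ideal_powM => //; apply: ideal_powX; apply: H.
Qed.

(** * Ideals of lines and their symbolic powers *)

Section LineIdeal.
Variable K : fieldType.
Hypothesis charK : [pchar K] =i pred0.
Implicit Types (l : line K) (M : 'M[K]_4) (f : {mpoly K[4]}) (v q x : 'rV[K]_4).

Definition line_ideal l : set {mpoly K[4]} :=
  [set f | forall v, v \in val l -> f.@[fun i => v 0 i] = 0].

(** The first two rows of the invertible matrix M span the line: in the coordinates x given by v = x
    M, the line is x_2 = x_3 = 0. *)
Definition line_basis l M : Prop :=
  [/\ M \in unitmx,
      forall x, (forall i : 'I_4, (1 < i)%N -> x 0 i = 0) -> x *m M \in val l &
      forall v, v \in val l ->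
        exists2 x, v = x *m M & forall i : 'I_4, (1 < i)%N -> x 0 i = 0].

Lemma vspace2_basis (V : {vspace 'rV[K]_4}) : \dim V == 2%N ->
  exists b0 b1, free [:: b0; b1] /\ V = <<[:: b0; b1]>>%VS.
Proof.
move=> /eqP dimV; have := size_tuple (vbasis V).
have := basis_free (vbasisP V); have := span_basis (vbasisP V).
by case: (tval _) => [|b0 [|b1 [|? ?]]]; rewrite dimV // => <- freeb _; exists b0, b1.
Qed.

Lemma line_basis_exists l : exists M, line_basis l M.
Proof.
have dimC : \dim (val l)^C == 2%N.
  by rewrite dimv_compl dimvf dim_matrix (eqP (valP l)).
have [b0 [b1 [freeb Eb]]] := vspace2_basis (valP l).
have [c0 [c1 [freec Ec]]] := vspace2_basis dimC.
have freebc : free [:: b0; b1; c0; c1].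
  rewrite (@cat_free _ _ [:: b0; b1] [:: c0; c1]) freeb freec -Eb -Ec /=.
  by apply/directv_addP/capv_compl.
pose X := [tuple b0; b1; c0; c1].
exists (\matrix_i tnth X i); split.
- rewrite -row_free_unit; apply: inj_row_free => x E; apply/rowP => i.
  rewrite [RHS]mxE; move/(@freeP _ _ _ X): freebc => /(_ (fun i => x 0 i)); apply.
  rewrite -[RHS]E; apply/rowP => j; rewrite summxE mxE; apply: eq_bigr => k _.
  by rewrite !mxE (tnth_nth 0).
- move=> x x0; have -> : x *m (\matrix_i tnth X i) = x 0 0 *: b0 + x 0 1 *: b1.
    apply/rowP => j; rewrite !mxE !big_ord_recl big_ord0 !mxE.
    rewrite (x0 (lift ord0 (lift ord0 ord0))) // (x0 (lift ord0 (lift ord0 (lift ord0 ord0)))) //.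
    rewrite !mul0r !addr0 //; congr (_ + x 0 _ * _); exact/val_inj.
  by rewrite Eb memvD // memvZ // memv_span // !inE eqxx ?orbT.
- move=> v; rewrite {1}Eb span_cons span_seq1 => /memv_addP[_ /vlineP[a ->] [_ /vlineP[b ->] ->]].
  exists (\row_i nth 0 [:: a; b] i); last by move=> i i1; rewrite mxE nth_default.
  apply/rowP => j; rewrite !mxE !big_ord_recl big_ord0 !mxE /= !mul0r !addr0 //.
Qed.

(* The coordinates transversal to the line are multiplied by the variable T of the
   outer polynomial ring, so that the order of vanishing along the line becomes the
   T-adic order, in a domain. *)
Definition normal_param M : {mpoly K[4]} -> {poly {mpoly K[4]}} :=
  mmap (polyC \o mpolyC 4 (R := K))
    (fun j => \sum_(i < 4) (M i j)%:MP%:P * (('X_i)%:P * (if (1 < i)%N then 'X else 1))).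

HB.instance Definition _ M := GRing.RMorphism.on (normal_param M).

(** The polynomial f (v + T q) in T: the behaviour of f at v in the direction q. *)
Definition along v q : {mpoly K[4]} -> {poly K} :=
  mmap polyC (fun i => (v 0 i)%:P + (q 0 i)%:P * 'X).

HB.instance Definition _ v q := GRing.RMorphism.on (along v q).

Definition linear_subst M : {mpoly K[4]} -> {mpoly K[4]} :=
  mmap (mpolyC 4 (R := K)) (fun j => \sum_(i < 4) (M i j)%:MP * 'X_i).

HB.instance Definition _ M := GRing.RMorphism.on (linear_subst M).

Lemma linear_substK M : M \in unitmx -> cancel (linear_subst M) (linear_subst (invmx M)).
Proof.
move=> uM f; rewrite /linear_subst rmorph_mmap -[RHS]comp_mpoly_id.
apply: eq_mmap => [c|j] /=; first by rewrite mmapC.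
rewrite tnth_mktuple rmorph_sum.
under eq_bigr => i _.
  rewrite rmorphM /= mmapC mmapX mmap1U mulr_sumr.
  under eq_bigr => k _ do rewrite mulrA -mpolyCM mulrC.
  over.
rewrite exchange_big /= (bigD1 j) //= [X in _ + X]big1 => [|k kj].
  rewrite -mulr_sumr -rmorph_sum /= -[X in X%:MP](_ : (invmx M *m M) j j = _).
    by rewrite mulVmx // mxE eqxx mpolyC1 mulr1 addr0.
  by rewrite mxE; apply: eq_bigr => i _; rewrite mulrC.
rewrite -mulr_sumr -rmorph_sum /= -[X in X%:MP](_ : (invmx M *m M) k j = _).
  by rewrite mulVmx // mxE (negPf kj) mpolyC0 mulr0.
by rewrite mxE; apply: eq_bigr => i _; rewrite mulrC.
Qed.

Definition normal_degree (m : 'X_{1..4}) : nat := (\sum_(i < 4 | (1 < i)%N) m i)%N.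

(** In the coordinates given by M, the coefficient of T^j collects the monomials of degree j in the
    two transversal variables. *)
Lemma coef_normal_param M f j m :
  (normal_param M f)`_j@_m = (linear_subst M f)@_m *+ (j == normal_degree m).
Proof.
pose h (i : 'I_4) : {poly {mpoly K[4]}} := ('X_i)%:P * (if (1 < i)%N then 'X else 1).
have -> : normal_param M f = mmap (polyC \o mpolyC 4 (R := K)) h (linear_subst M f).
  rewrite /linear_subst rmorph_mmap; apply: eq_mmap => [c|k] /=; first by rewrite mmapC.
  by rewrite rmorph_sum; apply: eq_bigr => i _; rewrite rmorphM /= mmapC mmapX mmap1U.
set F := linear_subst M f; rewrite /mmap coef_sum raddf_sum /=.
rewrite [in RHS](mpolyE F) raddf_sum /= -sumrMnl; apply: eq_bigr => n _.
rewrite mcoeffZ mcoeffX.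
have -> : mmap1 h n = ('X_[n])%:P * 'X^(normal_degree n).
  rewrite /mmap1 /h /normal_degree.
  under eq_bigr do rewrite exprMn.
  rewrite big_split /= mpolyXE_id rmorph_prod; congr (_ * _).
    by apply: eq_bigr => i _; rewrite rmorphXn.
  rewrite expr_sum [RHS]big_mkcond /=; apply: eq_bigr => i _.
  by case: ifP => // _; rewrite expr1n.
rewrite mulrA coefMXn -polyCM coefC mul_mpolyC.
case: ltngtP => [lt|gt|->].
- rewrite mcoeff0; case: (eqVneq n m) => [<-|]; rewrite ?mulr0 ?mul0rn //.
  by rewrite (ltn_eqF lt) mulr0n.
- rewrite subn_eq0 leqNgt gt /= mcoeff0.
  case: (eqVneq n m) => [<-|]; rewrite ?mulr0 ?mul0rn //.
  by rewrite (gtn_eqF gt) mulr0n.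
- rewrite subnn eqxx mcoeffZ mcoeffX.
  by case: (eqVneq n m) => [<-|]; rewrite ?eqxx ?mulr0 ?mul0rn.
Qed.

(** Each monomial of [linear_subst M f] has normal degree at least m; transported back, it is a
    multiple of that many linear forms vanishing on the line. *)
Lemma line_ideal_pow_of_normal l M m f : line_basis l M ->
  pow_dvd 'X m (normal_param M f) -> ideal_pow (line_ideal l) m f.
Proof.
move=> [uM _ Ml] /pow_dvdXP H; rewrite -[f](linear_substK uM).
rewrite {1}/linear_subst /mmap big_seq_cond; apply: ideal_gen_sum => n.
rewrite andbT => n_in; apply: ideal_genM.
rewrite /mmap1 (bigID (fun i : 'I_4 => (1 < i)%N)) /= mulrC; apply: ideal_genM.
apply: (@ideal_pow_le _ _ _ (normal_degree n)).
  rewrite leqNgt; apply/negP => /H/(congr1 (fun p => p@_n)).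
  by rewrite coef_normal_param eqxx mulr1n mcoeff0; apply/eqP; rewrite -mcoeff_msupp.
apply: ideal_pow_prod => i i1 v /Ml[x -> xi]; rewrite rmorph_sum /=.
under eq_bigr do rewrite mevalM mevalC mevalXU mulrC.
by have := xi i i1; rewrite -{1}(mulmxK uM x) mxE.
Qed.

(** At T = 0 the parametrization runs over points of the line, so an element of the line ideal has
    zero constant term. *)
Lemma normal_of_line_ideal_pow l M m f : line_basis l M ->
  ideal_pow (line_ideal l) m f -> pow_dvd 'X m (normal_param M f).
Proof.
move=> [_ Ml _]; apply: ideal_pow_dvd => h Ih; apply/pow_dvdXP => -[] // _.
rewrite -horner_coef0; apply: (mpoly_eq0_eval charK) => w.
rewrite -[LHS]/((meval w \o horner_eval 0) _) rmorph_mmap.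
have := Ih _ (Ml (\row_i (if (1 < i)%N then 0 else w i)) _).
rewrite /meval => <-; last by move=> i i1; rewrite mxE i1.
apply: eq_mmap => [c|j] /=; first by rewrite /horner_eval hornerC mevalC.
rewrite /horner_eval horner_sum rmorph_sum mxE; apply: eq_bigr => i _.
rewrite !hornerM !hornerC mxE; case: ifP => _; rewrite ?hornerX ?hornerC /=.
  by rewrite !mulr0 mul0r meval0.
by rewrite mulr1 rmorphM /= mevalC mevalXU mulrC.
Qed.

(** Membership is tested at points of the line, which later makes it a polynomial condition in
    Pluecker coordinates. Conversely, evaluating [normal_param M f] at w gives [along] for a point
    and a direction that depend on w. *)
Lemma line_ideal_powP l m f :
  ideal_pow (line_ideal l) m f <->
  forall v q, v \in val l -> pow_dvd 'X m (along v q f).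
Proof.
split=> [If v q vl|H].
  apply: ideal_pow_dvd If => h Ih; apply/pow_dvdXP => -[] // _.
  rewrite -horner_coef0 -[LHS]/(horner_eval 0 _) rmorph_mmap -[RHS](Ih _ vl).
  apply: eq_mmap => [c|j] /=; rewrite /horner_eval ?hornerC //.
  by rewrite hornerD hornerM hornerX !hornerC mulr0 addr0.
have [M lM] := line_basis_exists l; apply: (line_ideal_pow_of_normal lM).
have [_ Ml _] := lM; apply/pow_dvdXP => j jm.
apply: (mpoly_eq0_eval charK) => w.
pose x0 : 'rV[K]_4 := \row_i (if (1 < i)%N then 0 else w i).
pose x1 : 'rV[K]_4 := \row_i (if (1 < i)%N then w i else 0).
have lx0 : x0 *m M \in val l by apply: Ml => i i1; rewrite mxE i1.
have /pow_dvdXP/(_ j jm) := H _ (x1 *m M) lx0.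
have -> : along (x0 *m M) (x1 *m M) f = map_poly (meval w) (normal_param M f).
  rewrite rmorph_mmap; apply: eq_mmap => [c|k] /=.
    by rewrite map_polyC /= mevalC.
  rewrite rmorph_sum !mxE !rmorph_sum mulr_suml -big_split; apply: eq_bigr => i _.
  rewrite !mxE !rmorphM /= map_polyC /= mevalC map_polyC /= mevalXU.
  case: ifP => _; rewrite ?map_polyX ?rmorph1 ?polyC0 !(mul0r, add0r, addr0, mulr1) //.
    by rewrite -mulrA mulrCA mulrC -!mulrA; congr (_ * _); rewrite mulrC.
  by rewrite mulrC.
by rewrite coef_map.
Qed.

End LineIdeal.

Section SymbolicPowerOfLines.
Variable K : fieldType.
Hypothesis charK : [pchar K] =i pred0.
Implicit Types (l : line K) (f g h : {mpoly K[4]}).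

Lemma line_ideal_pow1 l f : ideal_pow (line_ideal l) 1 f <-> line_ideal l f.
Proof.
split=> [/(line_ideal_powP charK) H v vl|If]; last by rewrite -[f]expr1; apply: ideal_powX.
have /pow_dvdXP/(_ 0%N isT) := H v 0 vl.
rewrite -horner_coef0 => <-; rewrite -[RHS]/(horner_eval 0 _) rmorph_mmap.
apply: eq_mmap => [c|j] /=; rewrite /horner_eval ?hornerC //.
by rewrite hornerD hornerM hornerX !hornerC mulr0 addr0.
Qed.

Lemma line_ideal_normal l M f : line_basis l M ->
  line_ideal l f <-> (normal_param M f)`_0 = 0.
Proof.
move=> lM; split=> [/line_ideal_pow1/(normal_of_line_ideal_pow charK lM)/pow_dvdXP|H].
  by apply.
apply/line_ideal_pow1/(line_ideal_pow_of_normal lM)/pow_dvdXP.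
by case.
Qed.

(** The line ideal is the kernel of a morphism to a domain, which sends f to the constant term of
    [normal_param M f]. *)
Lemma line_ideal_prime l f g : line_ideal l (f * g) -> line_ideal l f \/ line_ideal l g.
Proof.
have [M lM] := line_basis_exists l.
rewrite !(line_ideal_normal _ lM) rmorphM coef0M => /eqP.
by rewrite mulf_eq0 => /orP[/eqP|/eqP]; [left|right].
Qed.

Lemma line_ideal1 l : ~ line_ideal l 1.
Proof.
by move=> /(_ 0 (mem0v _)) /eqP; rewrite meval1 oner_eq0.
Qed.

Lemma line_idealM l f g : line_ideal l g -> line_ideal l (f * g).
Proof. by move=> Ig v vl; rewrite mevalM Ig // mulr0. Qed.

(** Powers of the line ideal are primary: g has T-adic order 0 and can be cancelled. *)
Lemma line_ideal_pow_colon l m f g : ~ line_ideal l g ->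
  ideal_pow (line_ideal l) m (f * g) -> ideal_pow (line_ideal l) m f.
Proof.
have [M lM] := line_basis_exists l.
rewrite (line_ideal_normal _ lM) => /eqP g0 /(normal_of_line_ideal_pow charK lM).
rewrite rmorphM -[m in pow_dvd _ m _]addn0 => H.
apply: (line_ideal_pow_of_normal lM); apply: pow_dvdX_cancel H; last exact: g0.
by rewrite expr0 mulr1.
Qed.

Lemma linear_form_off_line l v : v \notin val l ->
  exists g, [/\ line_ideal l g, g \is 1.-homog & g.@[fun i => v 0 i] != 0].
Proof.
move=> vl; have [M [uM M2 Ml]] := line_basis_exists l.
have [i i1 xi] : exists2 i : 'I_4, (1 < i)%N & (v *m invmx M) 0 i != 0.
  apply: contrapT => H; case/negP: vl; rewrite -(mulmxKV uM v).
  by apply: M2 => i i1; apply/eqP; apply: contrapT => /negP xi; apply: H; exists i.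
have evE (w : 'rV[K]_4) :
    (\sum_(j < 4) (invmx M j i) *: 'X_j).@[fun j => w 0 j] = (w *m invmx M) 0 i.
  rewrite rmorph_sum mxE; apply: eq_bigr => j _.
  by rewrite /= mevalZ mevalXU mulrC.
exists (\sum_(j < 4) (invmx M j i) *: 'X_j); split.
- by move=> w /Ml[x -> x0]; rewrite evE mulmxK // x0.
- by apply: rpred_sum => j _; apply: rpredZ; rewrite dhomogX /= mdeg1.
- by rewrite evE.
Qed.

Lemma line_separating_form l l' : val l != val l' ->
  exists2 g, ~ line_ideal l g & line_ideal l' g.
Proof.
move=> ne; have /subvPn[v vl /linear_form_off_line[g [Ig _ gv]]] : ~~ (val l <= val l')%VS.
  apply: contra ne => le; rewrite eqEdim le /=.
  by rewrite (eqP (valP l)) (eqP (valP l')).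
by exists g => // /(_ v vl); apply/eqP.
Qed.

End SymbolicPowerOfLines.

Section SymbolicPowerP.
Variables (K : fieldType) (s : nat) (L : 'I_s -> line K).
Hypothesis charK : [pchar K] =i pred0.
Implicit Types (f g h : {mpoly K[4]}).

(** After inverting such a g, the ideal of the union and that of L_k agree. It is a product of
    polynomials vanishing on the other lines but not on L_k. *)
Lemma lines_separating_form k :
  exists2 g, ~ line_ideal (L k) g &
    forall h, line_ideal (L k) h -> lines_ideal L (g * h).
Proof.
have /choice[g Hg] j : exists g, ~ line_ideal (L k) g /\
    forall h, line_ideal (L k) h -> line_ideal (L j) (g * h).
  (* Lines that coincide with L_k contribute the factor 1. *)
  case: (eqVneq (val (L k)) (val (L j))) => [E|/line_separating_form[g g1 g2]].
    exists 1; split=> [|h Ih]; first exact: line_ideal1.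
    by rewrite mul1r => v; rewrite -E; apply: Ih.
  by exists g; split=> // h _; rewrite mulrC; apply: line_idealM.
exists (\prod_j g j).
  elim/big_ind: _ => [|a b Ha Hb /(line_ideal_prime charK)[]//|j _].
    exact: line_ideal1.
  by case: (Hg j).
move=> h Ih j; rewrite (bigD1 j) //= mulrAC mulrC; apply: line_idealM.
by apply: (Hg j).2.
Qed.

Lemma line_ideal_associated k : associated_primes (lines_ideal L) (line_ideal (L k)).
Proof.
have [g g1 g2] := lines_separating_form k; split.
  split.
    split=> [||a u v]; rewrite ?inE.
    - by move=> v _; rewrite meval0.
    - by apply/negP; rewrite inE; apply: line_ideal1.
    - move=> Iu Iv w wl; rewrite mevalD mevalM.
      by rewrite (Iu w wl) (Iv w wl) mulr0 addr0.
  move=> u v; rewrite !inE => /(line_ideal_prime charK)[] H; apply/orP; [left|right];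
    by rewrite inE.
exists g; apply/seteqP; split=> h /=; first by rewrite mulrC; apply: g2.
by move=> /(_ k)/(line_ideal_prime charK)[].
Qed.

(** Localizing at the ideal of L_k only introduces denominators outside it, and these cancel from
    its powers. Conversely, an associated prime (I : g0) lies inside the ideal of any L_k on which
    g0 does not vanish, so the m-th power of a separating g is an admissible denominator, and it
    moves f into I^m. *)
Lemma symbolic_powerP m f :
  symbolic_power (lines_ideal L) m f <-> forall k, ideal_pow (line_ideal (L k)) m f.
Proof.
split=> [H k|H P [primeP [g0 EP]]].
  have [a [g [Ia Ig E]]] := H _ (line_ideal_associated k).
  have g0 : g != 0 by apply/eqP => E0; apply: Ig; rewrite E0 => v _; rewrite meval0.
  have {}E : f * g = a.
    apply/eqP; rewrite -tofrac_eq tofracM E mulfVK //.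
    by rewrite tofrac_eq0.
  apply: (line_ideal_pow_colon charK Ig); rewrite E.
  have [n [r [b [Hb ->]]]] := Ia; apply: ideal_gen_sum => i _; apply: ideal_genM.
  have [c [Hc ->]] := Hb i; apply: ideal_gen_mem; exists c; split=> // j; exact: Hc.
have [k g0k] : exists k, ~ line_ideal (L k) g0.
  apply: contrapT => /forallNP H1.
  have [[_ P1 _] _] := primeP.
  case/negP: P1; apply/mem_set; rewrite EP /= mul1r => k; apply: contrapT; exact: H1.
have [g g1 g2] := lines_separating_form k.
have Ikg n : ~ line_ideal (L k) (g ^+ n).
  elim: n => [|n IH]; first exact: line_ideal1.
  by rewrite exprS => /(line_ideal_prime charK)[].
have Pg : ~ P (g ^+ m) by rewrite EP => /(_ k)/(line_ideal_prime charK)[]//; apply: Ikg.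
exists (f * g ^+ m), (g ^+ m); split=> //.
  have [n [r [b [Hb ->]]]] := H k; rewrite mulr_suml.
  apply: ideal_gen_sum => i _; rewrite -mulrA; apply: ideal_genM.
  have [c [Hc ->]] := Hb i; apply: ideal_gen_mem; exists (fun j => g * c j); split.
    by move=> j; apply: g2.
  by rewrite big_split /= prodr_const card_ord mulrC.
rewrite tofracM mulfK // tofrac_eq0 expf_neq0 //; apply/eqP => E0.
by apply: g1; rewrite E0 => v _; rewrite meval0.
Qed.

End SymbolicPowerP.

(** * Curves on P^1 x P^1 *)

Section Homogenization.
Variables (A : nzRingType) (S : comNzRingType) (phi : {additive A -> S}).
Implicit Types (p : {poly A}) (w x : S) (a : nat).

(** The form of degree a in (w, x) that dehomogenizes to p when p has degree at most a. The
    coefficient map is only additive, because it will itself be a homogenization in a second pair of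
    variables. *)
Definition homogenize a w x p : S := \sum_(i < a.+1) phi p`_i * (w ^+ (a - i) * x ^+ i).

Lemma homogenize_is_additive a w x : zmod_morphism (homogenize a w x).
Proof.
move=> p q; rewrite /homogenize -sumrB; apply: eq_bigr => i _ /=.
by rewrite coefB raddfB mulrBl.
Qed.

HB.instance Definition _ a w x :=
  GRing.isZmodMorphism.Build {poly A} S (homogenize a w x) (homogenize_is_additive a w x).

Lemma homogenize_mulX a w x p : homogenize a.+1 w x (p * 'X) = x * homogenize a w x p.
Proof.
rewrite /homogenize big_ord_recl coefMX eqxx raddf0 mul0r add0r mulr_sumr.
apply: eq_bigr => i _; rewrite /= /bump leq0n add1n coefMX /= subSS exprS.
by rewrite [RHS]mulrCA; congr (_ * _); rewrite mulrCA.
Qed.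

Lemma homogenize_raise a w x p : (size p <= a.+1)%N ->
  homogenize a.+1 w x p = w * homogenize a w x p.
Proof.
move=> sp; rewrite /homogenize big_ord_recr /= (nth_default _ sp) raddf0 mul0r addr0.
rewrite mulr_sumr; apply: eq_bigr => i _.
by rewrite subSn -1?ltnS // exprS -[in LHS]mulrA mulrCA.
Qed.

End Homogenization.

Lemma homogenize_scale (A : nzRingType) (S : comNzRingType) (phi phi' : {additive A -> S})
    a (w x c : S) (p p' : {poly A}) : (forall i, phi' p'`_i = c * phi p`_i) ->
  homogenize phi' a w x p' = c * homogenize phi a w x p.
Proof.
by move=> E; rewrite /homogenize mulr_sumr; apply: eq_bigr => i _; rewrite E -mulrA.
Qed.

Section Bihomogenization.
Variable K : fieldType.
Implicit Types (S : comNzRingType) (g : {poly {poly K}}) (a b n : nat).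

(* The form of bidegree (a, b) in (w, x) and (y, z) whose dehomogenization is g, with
   outer variable X = x / w and inner variable Y = z / y. *)
Definition bihomogenize S (f : {additive K -> S}) a b (w x y z : S) g : S :=
  homogenize (homogenize f b y z) a w x g.

Definition bidegree_le a b g : Prop :=
  (size g <= a.+1)%N /\ forall i, (size (g`_i)%R <= b.+1)%N.

Lemma bihomogenizeE S (f : {additive K -> S}) a b (w x y z : S) g :
  bihomogenize f a b w x y z g =
  \sum_(i < a.+1) \sum_(j < b.+1)
     f g`_i`_j * (w ^+ (a - i) * x ^+ i * (y ^+ (b - j) * z ^+ j)).
Proof.
apply: eq_bigr => i _; rewrite mulr_suml; apply: eq_bigr => j _.
by rewrite mulrAC -mulrA.
Qed.

Lemma bihomogenize_morph S S' (h : {rmorphism S -> S'}) (f : {additive K -> S})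
    (f' : {additive K -> S'}) a b (w x y z : S) g : (forall c, h (f c) = f' c) ->
  h (bihomogenize f a b w x y z g) = bihomogenize f' a b (h w) (h x) (h y) (h z) g.
Proof.
move=> E; rewrite !bihomogenizeE rmorph_sum; apply: eq_bigr => i _.
rewrite rmorph_sum; apply: eq_bigr => j _.
by rewrite !rmorphM !rmorphXn E.
Qed.

(* The substitution (w, x, y, z) -> (y, z, x, w) on forms: it turns the curve
   X^n Y = 1 into X = Y^n, and the point (t^n, t) into (t'^n, t') for t' = t^n when
   t^(n^2 + 1) = 1. *)
Definition flip a b g : {poly {poly K}} :=
  \poly_(i < b.+1) \poly_(j < a.+1) g`_j`_(b - i).

Lemma bidegree_le_flip a b g : bidegree_le b a (flip a b g).
Proof.
split=> [|i]; first exact: size_poly.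
by rewrite coef_poly; case: ifP => _; rewrite ?size_poly0 // size_poly.
Qed.

Lemma bihomogenize_flip S (f : {additive K -> S}) a b (w x y z : S) g :
  bihomogenize f b a w x y z (flip a b g) = bihomogenize f a b y z x w g.
Proof.
rewrite !bihomogenizeE exchange_big; apply: eq_bigr => i _ /=.
rewrite (reindex_inj rev_ord_inj) /=; apply: eq_bigr => j _.
have lej : (j <= b)%N by rewrite -ltnS.
rewrite coef_poly subSS ltnS leq_subr coef_poly ltn_ord subKn //.
by congr (_ * _); rewrite mulrC; congr (_ * _); rewrite mulrC.
Qed.

Lemma flip_neq0 a b g : bidegree_le a b g -> g != 0 -> flip a b g != 0.
Proof.
move=> [sg sgi]; apply: contra_neq => E; apply/polyP => i; apply/polyP => j.
rewrite !coef0; case: (leqP a.+1 i) => [le|lt].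
  by rewrite (nth_default _ (leq_trans sg le)) coef0.
case: (leqP b.+1 j) => [le|ltj]; first by rewrite nth_default // (leq_trans (sgi i)).
have := congr1 (fun p : {poly {poly K}} => p`_(b - j)`_i) E.
by rewrite !coef0 coef_poly ltnS leq_subr coef_poly lt subKn // -ltnS.
Qed.

(** The factor x y^n - w z^n is the equation of the curve X = Y^n, of bidegree (1, n). *)
Lemma bihomogenize_graph S (f : {additive K -> S}) a b n (w x y z : S) g :
  bidegree_le a b g ->
  bihomogenize f a.+1 (b + n) w x y z (g * ('X - ('X^n)%:P)) =
  (x * y ^+ n - w * z ^+ n) * bihomogenize f a b w x y z g.
Proof.
move=> [sg sgi]; rewrite mulrBr /bihomogenize raddfB /= homogenize_mulX mulrBl.
rewrite homogenize_raise; last first.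
  by rewrite mulrC mul_polyC (leq_trans (size_scale_leq _ _)).
rewrite -!mulrA; congr (_ * _ - _ * _); apply: homogenize_scale => i /=.
  elim: n => [|n IH]; first by rewrite addn0 mul1r.
  rewrite addnS exprS -mulrA -IH -homogenize_raise //.
  by rewrite (leq_trans (sgi i)) // ltnS leq_addr.
rewrite coefMC; elim: n => [|n IH]; first by rewrite addn0 mul1r mulr1.
by rewrite addnS [z ^+ _]exprS -[RHS]mulrA -IH -homogenize_mulX exprSr mulrA.
Qed.

(** The factor theorem over K[Y] divides g by X - Y^n. Degrees are additive in X and, after swapping
    the variables, in Y, which gives the bidegree of the quotient. *)
Lemma graph_division a b n g : bidegree_le a b g -> g != 0 -> g.['X^n] = 0 ->
  exists a' b' g', [/\ a = a'.+1, b = (b' + n)%N, g' != 0, bidegree_le a' b' g'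
    & g = g' * ('X - ('X^n)%:P)].
Proof.
move=> [sg sgi] g0 /eqP/factor_theorem[g' Eg].
have g'0 : g' != 0 by apply: contra_neq g0; rewrite Eg => ->; rewrite mul0r.
have sg' : size g = (size g').+1 by rewrite Eg size_Mmonic ?monicXsubC // size_XsubC addn2.
have sYh : sizeY ('X - ('X^n)%:P : {poly {poly K}}) = n.+1.
  rewrite sizeYE rmorphB /= swapXY_X swapXY_polyC map_polyXn -size_polyN opprB.
  case: n {Eg} => [|n]; last by rewrite size_XnsubC.
  by rewrite expr0 -polyC1 -polyCB size_polyC -opprB oppr_eq0 -polyC1 polyXsubC_eq0.
have sY : sizeY g = (sizeY g' + n)%N.
  rewrite Eg sizeYE rmorphM size_mul -?size_poly_gt0 -?sizeYE ?sYh ?addnS //.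
  by rewrite lt0n sizeY_eq0.
have sYg' : (0 < sizeY g')%N by rewrite lt0n sizeY_eq0.
have sYg : (sizeY g <= b.+1)%N by apply/bigmax_leqP => i _; apply: sgi.
have n_le_b : (n <= b)%N by lia.
exists a.-1, (b - n)%N, g'; split=> //.
- by move: sg; rewrite sg'; case: (a) => //; rewrite ltnS leqn0 size_poly_eq0 (negPf g'0).
- by rewrite subnK.
split=> [|i]; first by rewrite (leq_trans _ (leqSpred a)) // -ltnS -sg'.
by apply: leq_trans (max_size_coefXY _ _) _; lia.
Qed.

End Bihomogenization.

(** * Multiplicities at the points (t^n, t) of the curve X = Y^n *)

Section GraphPoints.
Variable K : fieldType.
Implicit Types (g : {poly {poly K}}) (a b n m : nat) (t : K) (ts : seq K).

Local Notation o0 := (@Ordinal 4 0 isT).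
Local Notation o1 := (@Ordinal 4 1 isT).
Local Notation o2 := (@Ordinal 4 2 isT).
Local Notation o3 := (@Ordinal 4 3 isT).

Definition moving_coord (c : K) (i : 'I_4) : {poly {mpoly K[4]}} :=
  c%:MP%:P + 'X * ('X_i)%:P.

(* The multiplicity at (t^n, t), tested in all homogeneous coordinates along the
   generic direction ('X_0, ..., 'X_3), so that it is again a T-adic order in a
   domain. *)
Definition order_ge a b n m t g : Prop :=
  pow_dvd 'X m (bihomogenize (polyC \o mpolyC 4 (R := K)) a b
    (moving_coord 1 o0) (moving_coord (t ^+ n) o1)
    (moving_coord 1 o2) (moving_coord t o3) g).

(** The generic direction specializes to any direction (p0, p1, p2, p3), with tau in the place of
    T. *)
Lemma order_ge_at (S : comNzRingType) (f : {rmorphism K -> S}) (tau p0 p1 p2 p3 : S)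
    a b n m t g : order_ge a b n m t g ->
  pow_dvd tau m (bihomogenize f a b (1 + tau * p0) (f t ^+ n + tau * p1)
    (1 + tau * p2) (f t + tau * p3) g).
Proof.
pose P (i : 'I_4) := nth 0 [:: p0; p1; p2; p3] i.
pose h : {rmorphism {poly {mpoly K[4]}} -> S} := horner_eval tau \o map_poly (mmap f P).
have hc c i : h (moving_coord c i) = f c + tau * P i.
  rewrite /h /moving_coord /= /horner_eval !(rmorphD, rmorphM) /=.
  rewrite map_polyX !map_polyC hornerD hornerM hornerX !hornerC /= mmapC mmapX mmap1U //.
have hX : h 'X = tau by rewrite /h /= map_polyX /horner_eval hornerX.
have hC c : h ((polyC \o mpolyC 4 (R := K)) c) = f c.
  by rewrite /h /= map_polyC /= /horner_eval hornerC mmapC.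
rewrite /order_ge; move: hX hC (hc 1 o0) (hc (t ^+ n) o1) (hc 1 o2) (hc t o3); clear hc; move: h => h hX hC.
move: (moving_coord 1 o0) (moving_coord _ o1) (moving_coord 1 o2) (moving_coord t o3).
move=> w x y z Ew Ex Ey Ez /(pow_dvd_morph h).
by rewrite (bihomogenize_morph _ _ _ _ _ _ _ hC) hX Ew Ex Ey Ez rmorph1 rmorphXn.
Qed.

(** The direction is chosen so that the displaced point ((t + T)^n, t + T) stays on the curve; the
    multiplicity thus bounds from below the order at Y = t of the restriction g (Y^n, Y). *)
Lemma order_ge_root a b n m t g : bidegree_le a b g -> order_ge a b n m t g ->
  ('X - t%:P) ^+ m %| g.['X^n].
Proof.
move=> [sg sgi]; set z := 'X + t%:P.
have [p1 Ep1] : exists p1, z ^+ n = (t ^+ n)%:P + 'X * p1.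
  exists (\sum_(i < n) z ^+ (n.-1 - i) * t%:P ^+ i).
  have := subrXX z t%:P n; rewrite addrK => <-.
  by rewrite rmorphXn addrCA subrr addr0.
move=> /(order_ge_at polyC 'X 0 p1 0 1).
rewrite mulr0 addr0 -rmorphXn -Ep1 mulr1 [_ + 'X]addrC -/z => -[r E].
suff EG : g.['X^n] \Po z = r * 'X^m.
  rewrite -[g.['X^n]](comp_polyXaddC_K _ t) -/z EG comp_polyM comp_Xn_poly.
  exact: dvdp_mull.
rewrite -E bihomogenizeE (horner_coef_wide _ sg) rmorph_sum; apply: eq_bigr => i _.
rewrite rmorphM !rmorphXn /= comp_polyX /comp_poly.
rewrite (@horner_coef_wide _ b.+1) ?size_map_polyC // mulr_suml; apply: eq_bigr => j _.
by rewrite coef_map /= !expr1n !mul1r -mulrA; congr (_ * _); rewrite mulrC.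
Qed.

Lemma prod_XsubC_exp_dvdp ts m (p : {poly K}) : uniq ts ->
  {in ts, forall t, ('X - t%:P) ^+ m %| p} -> \prod_(t <- ts) ('X - t%:P) ^+ m %| p.
Proof.
elim: ts => [|t ts IH] /=; first by rewrite big_nil dvd1p.
move=> /andP[t_ts uts] H; rewrite big_cons Gauss_dvdp.
  rewrite H ?mem_head //= IH // => u uin; apply: H; by rewrite inE uin orbT.
apply: coprimep_expl; rewrite coprimep_sym coprimep_XsubC /root horner_prod.
rewrite prodf_seq_neq0; apply/allP => u uin /=.
rewrite horner_exp hornerXsubC expf_neq0 // subr_eq0.
by apply: contra t_ts => /eqP ->.
Qed.

(** The restriction of g to the curve is a nonzero polynomial of degree at most n a + b with a root
    of order at least m at each t. *)
Lemma order_ge_bezout a b n m ts g : bidegree_le a b g -> uniq ts ->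
  {in ts, forall t, order_ge a b n m t g} -> g.['X^n] != 0 ->
  (size ts * m <= n * a + b)%N.
Proof.
move=> deg uts H G0.
have := dvdp_leq G0 (prod_XsubC_exp_dvdp uts (fun t tin => order_ge_root deg (H t tin))).
have szP : size (\prod_(t <- ts) ('X - t%:P) ^+ m) = (size ts * m).+1.
  rewrite prodrXl -[LHS]prednK ?size_exp ?size_prod_XsubC //.
  by rewrite size_poly_gt0 monic_neq0 // monic_exp // monic_prod_XsubC.
rewrite szP => le; rewrite -ltnS (leq_trans le) //.
have [sg sgi] := deg; rewrite (horner_coef_wide _ sg).
apply: (leq_trans (size_sum _ _ _)); apply/bigmax_leqP => i _.
rewrite -exprM; have [->|c0] := eqVneq g`_i 0; first by rewrite mul0r size_poly0.
rewrite size_mulXn // -addnS; apply: leq_add => //.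
by rewrite leq_mul2l -ltnS ltn_ord orbT.
Qed.

(** The curve passes through the point and is smooth there, so its equation has T-adic order exactly
    1, and dividing by it costs one order. *)
Lemma order_ge_graph a b n m t g : bidegree_le a b g ->
  order_ge a.+1 (b + n) n m.+1 t (g * ('X - ('X^n)%:P)) -> order_ge a b n m t g.
Proof.
move=> deg; rewrite /order_ge bihomogenize_graph //.
set w := moving_coord 1 o0; set x := moving_coord _ o1.
set y := moving_coord _ o2; set z := moving_coord t o3.
set h := (x * y ^+ n - w * z ^+ n).
rewrite mulrC -[m.+1]addn1; apply: (@pow_dvdX_cancel _ _ 1 (drop_poly 1 h)).
  rewrite -[LHS](poly_take_drop 1).
  suff -> : take_poly 1 h = 0 by rewrite add0r.
  apply/polyP => -[|i]; rewrite coef_take_poly coef0 //=.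
  rewrite -horner_coef0 /h !(hornerE, horner_exp) /=.
  by rewrite mpolyC1 expr1n mulr1 rmorphXn subrr.
rewrite coef_drop_poly add0n.
(* The linear term of h is nonzero: in the x-direction h restricts to T. *)
have Eh : map_poly (meval (fun i => (i == o1)%:R)) h = 'X :> {poly K}.
  have mc c i : map_poly (meval (fun i => (i == o1)%:R)) (moving_coord c i)
      = c%:P + 'X * ((i == o1)%:R)%:P.
    by rewrite rmorphD rmorphM /= map_polyX !map_polyC /= mevalC mevalXU.
  move: (mc 1 o0) (mc (t ^+ n) o1) (mc 1 o2) (mc t o3).
  rewrite /= !polyC0 !mulr0 !addr0 mulr1 -/w -/x -/y -/z.
  rewrite /h; clear h; move: w x y z => w x y z Ew Ex Ey Ez.
  rewrite rmorphB !rmorphM !rmorphXn /= Ew Ex Ey Ez.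
  by rewrite expr1n mulr1 mul1r rmorphXn addrAC subrr add0r.
apply/eqP => h1; have := congr1 (fun p : {poly K} => p`_1) Eh.
by rewrite coef_map h1 raddf0 coefX => /esym/eqP; rewrite oner_eq0.
Qed.

Lemma order_ge_flip a b n m t g : t ^+ (n ^ 2).+1 = 1 ->
  order_ge a b n m t g -> order_ge b a n m (t ^+ n) (flip a b g).
Proof.
move=> t1; rewrite {2}/order_ge bihomogenize_flip.
have t0 : t != 0 by apply: contra_eq_neq t1 => ->; rewrite expr0n /= eq_sym oner_eq0.
pose c : {rmorphism K -> {poly {mpoly K[4]}}} := polyC \o mpolyC 4 (R := K).
move=> /(order_ge_at c 'X ('X_o2)%:P ('X_o3)%:P (c t * ('X_o1)%:P) (c t * ('X_o0)%:P)).
have cE u i : c u + 'X * ('X_i)%:P = moving_coord u i by [].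
(* After the flip, the second pair at the point is (t^(n^2), 1); multiplied by t it becomes (1, t),
   and the resulting factor t^b is invertible. *)
have -> : 1 + 'X * (c t * ('X_o1)%:P) = c t * moving_coord (t ^+ n ^+ n) o1.
  by rewrite -cE mulrDr -rmorphM -exprM mulnn -exprS t1 rmorph1 mulrCA.
have -> : c t + 'X * (c t * ('X_o0)%:P) = c t * moving_coord 1 o0.
  by rewrite -cE rmorph1 mulrDr mulr1 mulrCA.
rewrite -(rmorph1 c) -rmorphXn !cE /bihomogenize.
have -> : forall W X Y Z, homogenize (homogenize c b (c t * Y) (c t * Z)) a W X g =
    c t ^+ b * homogenize (homogenize c b Y Z) a W X g.
  move=> W X Y Z; apply: homogenize_scale => i.
  rewrite /homogenize mulr_sumr; apply: eq_bigr => j _ /=.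
  by rewrite [RHS]mulrCA !exprMn mulrACA -exprD subnK -1?ltnS.
move=> /(pow_dvd_mull (c (t ^- b))); rewrite mulrA -rmorphXn -rmorphM mulVf ?expf_neq0 //.
by rewrite rmorph1 mul1r.
Qed.

Lemma graph_or_bezout a b n m ts g : bidegree_le a b g -> g != 0 -> uniq ts ->
  {in ts, forall t, order_ge a b n m.+1 t g} ->
  (size ts * m.+1 <= n * a + b)%N \/
  exists a' b' g', [/\ a = a'.+1, b = (b' + n)%N, g' != 0, bidegree_le a' b' g' &
    {in ts, forall t, order_ge a' b' n m t g'}].
Proof.
move=> deg g0 uts H; have [E|G0] := eqVneq g.['X^n] 0; last first.
  by left; apply: order_ge_bezout G0.
right; have [a' [b' [g' [Ea Eb g'0 deg' Eg]]]] := graph_division deg g0 E.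
exists a', b', g'; split=> // t tin; apply: order_ge_graph => //.
by rewrite -Eg -Ea -Eb; apply: H.
Qed.

Lemma bidegree_lower_bound a b n m ts g : uniq ts ->
  {in ts, forall t, t ^+ (n ^ 2).+1 = 1} -> (n.+1 ^ 2 <= 2 * size ts)%N ->
  bidegree_le a b g -> g != 0 -> {in ts, forall t, order_ge a b n m t g} ->
  (n.+1 * m <= a + b)%N.
Proof.
elim: m a b ts g => [|m IH] a b ts g uts rts sts deg g0 H; first by rewrite muln0.
have [B1|] := graph_or_bezout deg g0 uts H; last first.
  move=> [a' [b' [g' [-> -> g'0 deg' H']]]].
  by have := IH _ _ _ _ uts rts sts deg' g'0 H'; lia.
(* Since (t^n)^n is the inverse of t, taking n-th powers is injective on [ts]. *)
pose ts' := [seq t ^+ n | t <- ts].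
have uts' : uniq ts'.
  rewrite map_inj_in_uniq // => t u tin uin E.
  have t0 : t ^+ (n ^ 2) != 0.
    have := rts _ tin; rewrite exprS; apply: contra_eq_neq => ->.
    by rewrite mulr0 eq_sym oner_eq0.
  apply: (mulIf t0); rewrite -exprS rts // -mulnn exprM E -exprM mulnn -exprS rts //.
have rts' : {in ts', forall t, t ^+ (n ^ 2).+1 = 1}.
  by move=> _ /mapP[t tin ->]; rewrite exprAC rts // expr1n.
have sts' : (n.+1 ^ 2 <= 2 * size ts')%N by rewrite size_map.
have deg' := bidegree_le_flip a b g; have g'0 := flip_neq0 deg g0.
have H' : {in ts', forall t, order_ge b a n m.+1 t (flip a b g)}.
  by move=> _ /mapP[t tin ->]; apply: order_ge_flip; [apply: rts|apply: H].
have [B2|] := graph_or_bezout deg' g'0 uts' H'; last first.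
  move=> [a' [b' [g' [-> -> g''0 deg'' H'']]]].
  by have := IH _ _ _ _ uts' rts' sts' deg'' g''0 H''; lia.
(* The two Bezout inequalities add up to 2 s' (m + 1) <= (n + 1) (a + b), where s' is the size of
   [ts] and 2 s' >= (n + 1)^2. *)
rewrite size_map in B2; nia.
Qed.

End GraphPoints.

(** * Bihomogeneous components of forms vanishing along a line *)

Lemma pow_dvd_polyCP (S : comNzRingType) (tau : S) m (p : {poly S}) :
  pow_dvd tau%:P m p <-> forall i, pow_dvd tau m p`_i.
Proof.
split=> [[r ->] i|/choice[r Hr]]; first by exists r`_i; rewrite -rmorphXn coefMC.
exists (\poly_(i < size p) r i); apply/polyP => i.
rewrite -rmorphXn coefMC coef_poly; case: ltnP => [_|le]; first exact: Hr.
by rewrite nth_default // mul0r.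
Qed.

Section Components.
Variable K : fieldType.
Hypothesis charK : [pchar K] =i pred0.
Implicit Types (f h : {mpoly K[4]}) (a b n m d : nat) (t : K) (l : line K).

Local Notation o0 := (@Ordinal 4 0 isT).
Local Notation o1 := (@Ordinal 4 1 isT).
Local Notation o2 := (@Ordinal 4 2 isT).
Local Notation o3 := (@Ordinal 4 3 isT).

Definition monom4 (i0 i1 i2 i3 : nat) : 'X_{1..4} := [multinom [tuple i0; i1; i2; i3]].

Lemma monom4E (m : 'X_{1..4}) : m = monom4 (m o0) (m o1) (m o2) (m o3).
Proof.
apply/mnmP => -[[|[|[|[|//]]]] Hi]; rewrite multinomE (tnth_nth 0%N) /=;
  by congr (m _); apply: val_inj.
Qed.

Lemma mdeg_monom4 i0 i1 i2 i3 : mdeg (monom4 i0 i1 i2 i3) = (i0 + i1 + (i2 + i3))%N.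
Proof. by rewrite /mdeg /= !big_cons big_nil; lia. Qed.

(** The part of f of bidegree (a, b) in the pairs (x_0, x_1) and (x_2, x_3), dehomogenized at x_0 =
    x_2 = 1. *)
Definition component a b f : {poly {poly K}} :=
  \poly_(i < a.+1) \poly_(j < b.+1) f@_(monom4 (a - i) i (b - j) j).

Lemma bidegree_le_component a b f : bidegree_le a b (component a b f).
Proof.
split=> [|i]; first exact: size_poly.
by rewrite coef_poly; case: ifP => _; rewrite ?size_poly0 // size_poly.
Qed.

Lemma component_neq0 d f : f != 0 -> f \is d.-homog ->
  exists a b, d = (a + b)%N /\ component a b f != 0.
Proof.
move=> f0 /dhomogP fd; have := mlead_supp f0; set m := mlead f => mf.
have := fd m mf; rewrite [m]monom4E /= mdeg_monom4 => <-.
exists (m o0 + m o1)%N, (m o2 + m o3)%N; split=> //.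
move: mf; rewrite mcoeff_msupp; apply: contra_neq => E.
have := congr1 (fun p : {poly {poly K}} => p`_(m o1)`_(m o3)) E.
by rewrite !coef0 coef_poly ltnS leq_addl coef_poly ltnS leq_addl !addnK -monom4E.
Qed.

(** A marker variable multiplies the first pair; in a form of degree a + b, the coefficient of its
    a-th power is the part of bidegree (a, b). *)
Lemma bihomogenize_component (S : comNzRingType) (c : {rmorphism K -> S})
    (w x y z : S) a b d f : f \is d.-homog -> d = (a + b)%N ->
  bihomogenize c a b w x y z (component a b f) =
  (mmap (polyC \o c) (fun i : 'I_4 => nth 0 [:: w%:P * 'X; x%:P * 'X; y%:P; z%:P] i) f)`_a.
Proof.
move=> /dhomogP fd Ed; rewrite bihomogenizeE /mmap coef_sum.
pose M (m : 'X_{1..4}) := w ^+ m o0 * x ^+ m o1 * (y ^+ m o2 * z ^+ m o3).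
transitivity (\sum_(m <- msupp f) c f@_m * M m *+ (m o0 + m o1 == a)%N); last first.
  apply: eq_bigr => m _; rewrite coefCM -mulrnAr; congr (_ * _).
  have -> : mmap1 (fun i : 'I_4 => nth 0 [:: w%:P * 'X; x%:P * 'X; y%:P; z%:P] i) m =
      (M m)%:P * 'X^(m o0 + m o1).
    rewrite /mmap1 !big_ord_recl big_ord0 /= !exprMn mulr1 /M !polyCM !rmorphXn exprD.
    have e1 : lift ord0 ord0 = o1 :> 'I_4 by apply: val_inj.
    have e2 : lift ord0 (lift ord0 ord0) = o2 :> 'I_4 by apply: val_inj.
    have e3 : lift ord0 (lift ord0 (lift ord0 ord0)) = o3 :> 'I_4 by apply: val_inj.
    have e0 : ord0 = o0 :> 'I_4 by apply: val_inj.
    by rewrite e1 e2 e3 e0; ring.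
  by rewrite coefCM coefXn eq_sym; case: eqP; rewrite ?mulr1 ?mulr0.
transitivity (\sum_(i < a.+1) \sum_(j < b.+1) \sum_(m <- msupp f)
    c f@_m * M m *+ (m == monom4 (a - i) i (b - j) j)).
  apply: eq_bigr => i _; apply: eq_bigr => j _.
  rewrite coef_poly ltn_ord coef_poly ltn_ord.
  set k := monom4 _ _ _ _.
  have -> : w ^+ (a - i) * x ^+ i * (y ^+ (b - j) * z ^+ j) = M k.
    by rewrite /M !multinomE !(tnth_nth 0%N).
  rewrite [in LHS](mpolyE f) raddf_sum /= rmorph_sum mulr_suml; apply: eq_bigr => m _.
  rewrite mcoeffZ mcoeffX; case: eqP => [->|_]; rewrite ?mulr1 //.
  by rewrite mulr0 rmorph0 mul0r.
under eq_bigr do rewrite exchange_big.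
rewrite exchange_big /= big_seq [RHS]big_seq; apply: eq_bigr => m mf.
under eq_bigr do rewrite sumrMnr.
rewrite sumrMnr; congr (_ *+ _).
have := fd m mf; rewrite {1}[m]monom4E /= mdeg_monom4 Ed => Em.
have Ek i j : (m == monom4 (a - i) i (b - j) j) =
    [&& m o0 == a - i, m o1 == i, m o2 == b - j & m o3 == j]%N.
  rewrite {1}[m]monom4E; apply/eqP/and4P => [E|[/eqP-> /eqP-> /eqP-> /eqP->] //].
  have E' k := congr1 (fun p : 'X_{1..4} => p k) E.
  move: (E' o0) (E' o1) (E' o2) (E' o3).
  by rewrite !multinomE !(tnth_nth 0%N) /= => -> -> -> ->; rewrite !eqxx.
case: eqP => [Ea|Na]; last first.
  rewrite big1 // => i _; rewrite big1 // => j _; rewrite Ek.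
  case: and4P => // -[/eqP e0 /eqP e1 /eqP e2 /eqP e3].
  case: Na; rewrite e0 e1 subnK // -ltnS //.
have lt1 : (m o1 < a.+1)%N by rewrite ltnS -Ea leq_addl.
have lt3 : (m o3 < b.+1)%N by lia.
rewrite (bigD1 (Ordinal lt1)) //= (bigD1 (Ordinal lt3)) //= Ek.
rewrite big1 => [|j nj]; last first.
  by rewrite Ek; case: and4P => // -[_ _ _ /eqP e3]; case/eqP: nj; apply: val_inj.
rewrite big1 => [|i ni]; last first.
  rewrite big1 // => j _; rewrite Ek.
  by case: and4P => // -[_ /eqP e1 _ _]; case/eqP: ni; apply: val_inj.
rewrite !eqxx !addn0.
have -> : (m o0 == a - m o1)%N by apply/eqP; lia.
by have -> : (m o2 == b - m o3)%N by apply/eqP; lia.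
Qed.

(** As the line contains (u, u t^n, 1, t) for all u, multiplying the first pair by the marker does
    not leave the line at T = 0. Hence T^m divides f over the ring with the marker, and so divides
    each coefficient. *)
Lemma order_ge_component l a b n m d t f :
  (forall u, \row_(i < 4) nth 0 [:: u; u * t ^+ n; 1; t] i \in val l) ->
  f \is d.-homog -> d = (a + b)%N -> ideal_pow (line_ideal l) m f ->
  order_ge a b n m t (component a b f).
Proof.
move=> Hl fd Ed; rewrite /order_ge (bihomogenize_component _ _ _ _ _ fd Ed).
set H := (fun i : 'I_4 => _).
move=> If; suff /pow_dvd_polyCP : pow_dvd 'X%:P m
    (mmap (polyC \o (polyC \o mpolyC 4 (R := K))) H f) by apply.
apply: ideal_pow_dvd If => h Ih; apply/pow_dvd_polyCP => i; apply/pow_dvdXP => -[] // _.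
pose q : {poly K} := mmap polyC (fun i : 'I_4 => nth 0 [:: 'X; 'X * (t ^+ n)%:P; 1; t%:P] i) h.
have q0 : q = 0.
  apply/eqP; apply: contrapT => /negP/(poly_nonroot charK)[u].
  case/eqP; rewrite -(Ih _ (Hl u)) /q -[LHS]/(horner_eval u _) rmorph_mmap.
  apply: eq_mmap => [c|j] /=; rewrite /horner_eval ?hornerC // mxE.
  by case: j => -[|[|[|[|//]]]] ? /=; rewrite !hornerE.
have : map_poly (horner_eval 0) (mmap (polyC \o (polyC \o mpolyC 4 (R := K))) H h) =
    map_poly (mpolyC 4 (R := K)) q.
  rewrite /q !rmorph_mmap; apply: eq_mmap => [c|j] /=.
    by rewrite !map_polyC /= /horner_eval hornerC.
  rewrite /H /moving_coord; case: j => -[|[|[|[|//]]]] ? /=;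
    rewrite ?rmorphM /= ?map_polyX !map_polyC /= /horner_eval;
    rewrite hornerD hornerM hornerX hornerC mul0r addr0 // ?rmorph1 ?mul1r //.
  by rewrite mulrC.
rewrite q0 rmorph0 => /polyP/(_ i); rewrite coef_map coef0 /= /horner_eval.
by rewrite horner_coef0.
Qed.

Lemma graph_line_exists n t : exists l : line K,
  forall u, \row_(i < 4) nth 0 [:: u; u * t ^+ n; 1; t] i \in val l.
Proof.
pose e0 : 'rV[K]_4 := \row_i nth 0 [:: 1; t ^+ n; 0; 0] i.
pose e1 : 'rV[K]_4 := \row_i nth 0 [:: 0; 0; 1; t] i.
have dimV : \dim <<[:: e0; e1]>> == 2%N.
  suff : free [:: e0; e1] by [].
  apply/(@freeP _ _ _ [tuple e0; e1]) => k.
  rewrite !big_ord_recl big_ord0 addr0 /= => E i.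
  have E0 := congr1 (fun M : 'rV_4 => M 0 o0) E.
  have E2 := congr1 (fun M : 'rV_4 => M 0 o2) E.
  move: E0 E2; rewrite !mxE /= !mulr1 !mulr0 addr0 add0r => E0 E1.
  case: i => -[|[|//]] Hi; rewrite -[RHS]E0 //; first by congr k; apply: val_inj.
  by rewrite E0 -[RHS]E1; congr k; apply: val_inj.
exists (exist (fun V : {vspace 'rV[K]_4} => \dim V == 2%N) _ dimV) => u.
suff -> : \row_(i < 4) nth 0 [:: u; u * t ^+ n; 1; t] i = u *: e0 + e1.
  by rewrite memvD ?memvZ ?memv_span ?inE ?eqxx ?orbT.
apply/rowP => i; rewrite !mxE.
by case: i => -[|[|[|[|//]]]] ? /=; rewrite ?mulr0 ?mulr1 ?addr0 ?add0r.
Qed.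

End Components.

(** * The special configuration of lines, from roots of unity *)

Lemma unity_roots_exist (K : closedFieldType) n : [pchar K] =i pred0 -> (0 < n)%N ->
  exists ts : seq K, [/\ uniq ts, size ts = n & {in ts, forall t, t ^+ n = 1}].
Proof.
move=> charK n0; have [ts E] := closed_field_poly_normal ('X^n - 1 : {poly K}).
have monX : ('X^n - 1 : {poly K}) \is monic by rewrite monicXnsubC.
rewrite (monicP monX) scale1r in E; exists ts; split.
- rewrite -separable_prod_XsubC -E separable_Xn_sub_1 //.
  by rewrite ((pcharf0P K).1 charK) -lt0n.
- by have := congr1 (fun p : {poly K} => size p) E; rewrite /= size_XnsubC // size_prod_XsubC => -[].
- move=> t tin; apply/eqP; rewrite -subr_eq0; have : root ('X^n - 1) t by rewrite E root_prod_XsubC.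
  by rewrite rootE !hornerE.
Qed.

Lemma special_lines (K : closedFieldType) (s k : nat) : [pchar K] =i pred0 ->
  (k ^ 2 < 2 * s)%N ->
  exists L : 'I_s -> line K, forall m d (f : {mpoly K[4]}), f != 0 -> f \is d.-homog ->
    (forall i, ideal_pow (line_ideal (L i)) m f) -> (k * m <= d)%N.
Proof.
move=> charK ks; case: k ks => [|n] ks.
  by have [l _] := graph_line_exists 0 (1 : K); exists (fun=> l).
have [ts [uts sts rts]] := unity_roots_exist charK (ltn0Sn (n ^ 2)).
have /choice[l Hl] := @graph_line_exists K n.
(* Past the n^2 + 1 roots, the default 1 repeats the line for t = 1; only the first min (s, n^2 + 1)
   lines are tested. *)
exists (fun i => l (nth 1 ts i)) => m d f f0 fd If.
have [a [b [Ed g0]]] := component_neq0 f0 fd; rewrite Ed.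
apply: (@bidegree_lower_bound _ a b n m (take s ts) (component a b f)) => //.
- exact: take_uniq.
- by move=> t /mem_take; apply: rts.
(* If all the roots are used, 2 (n^2 + 1) - (n + 1)^2 = (n - 1)^2; otherwise (n + 1)^2 < 2 s is the
   hypothesis. *)
- by rewrite size_take sts; case: ifP => _; nia.
- exact: bidegree_le_component.
move=> t /(nthP 1)[i]; rewrite size_take => lti <-.
have lt_is : (i < s)%N by apply: leq_trans lti _; case: ifP => // /negbT; rewrite -leqNgt.
rewrite nth_take //; apply: (order_ge_component charK _ fd Ed (If (Ordinal lt_is))) => u.
exact: Hl.
Qed.

(** * Semicontinuity in Pluecker coordinates *)

Section SkewForm.
Variable S : comNzRingType.
Implicit Types (x : 'I_6 -> S) (c : 'I_4 -> S).

(* The skew-symmetric matrix with the given Pluecker coordinates as minors; its rows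
   span the line. *)
Definition skew x (p q : 'I_4) : S :=
  \sum_(j < 6) x j * (((p, q) == plucker_pair j)%:R - ((q, p) == plucker_pair j)%:R).

Definition skew_row c x (q : 'I_4) : S := \sum_(p < 4) c p * skew x p q.

Lemma skew_minors (u v : 'I_4 -> S) (p q : 'I_4) :
  skew (fun j => u (plucker_pair j).1 * v (plucker_pair j).2
               - u (plucker_pair j).2 * v (plucker_pair j).1) p q
  = u p * v q - u q * v p.
Proof.
rewrite /skew !big_ord_recl big_ord0 /plucker_pair /= /bump /=.
have e k (lt_k4 : (k < 4)%N) : inord k = Ordinal lt_k4 by apply: val_inj; rewrite /= inordK.
rewrite (e 0%N isT) (e 1%N isT) (e 2%N isT) (e 3%N isT).
case: p => -[|[|[|[|//]]]] Hp; rewrite (bool_irrelevance Hp isT);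
case: q => -[|[|[|[|//]]]] Hq; rewrite (bool_irrelevance Hq isT);
rewrite !xpair_eqE -!val_eqE /=; ring.
Qed.

End SkewForm.

Lemma skew_row_morph (S S' : comNzRingType) (h : {rmorphism S -> S'}) c x q :
  h (skew_row c x q) = skew_row (h \o c) (h \o x) q.
Proof.
rewrite rmorph_sum; apply: eq_bigr => p _; rewrite rmorphM rmorph_sum; congr (_ * _).
by apply: eq_bigr => j _; rewrite rmorphM rmorphB !rmorph_nat.
Qed.

Section PluckerSpan.
Variable K : fieldType.
Implicit Types (l : line K) (c v : 'rV[K]_4).

(** The row c times the skew matrix: a point of the line that is linear in the Pluecker
    coordinates. *)
Definition plucker_point l c : 'rV[K]_4 := \row_q skew_row (c 0) (plucker l 0) q.

Lemma plucker_pointE l c : plucker_point l c =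
  (\sum_(p < 4) c 0 p * (vbasis (val l))`_0 0 p) *: (vbasis (val l))`_1
  - (\sum_(p < 4) c 0 p * (vbasis (val l))`_1 0 p) *: (vbasis (val l))`_0.
Proof.
apply/rowP => q; rewrite !mxE !mulr_suml -sumrB; apply: eq_bigr => p _.
set b0 := _`_0; set b1 := _`_1.
rewrite -!mulrA -mulrBr -[b1 0 p * _]mulrC -skew_minors; congr (_ * _).
apply: eq_bigr => j _; congr (_ * _); rewrite mxE.
by case: (plucker_pair j).
Qed.

Lemma vbasis_line l : free [:: (vbasis (val l))`_0; (vbasis (val l))`_1] /\
  val l = <<[:: (vbasis (val l))`_0; (vbasis (val l))`_1]>>%VS.
Proof.
have := size_tuple (vbasis (val l)); rewrite {2}(eqP (valP l)).
have := basis_free (vbasisP (val l)); have := span_basis (vbasisP (val l)).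
by case: (tval _) => [|b0 [|b1 [|? ?]]].
Qed.

Lemma plucker_point_mem l c : plucker_point l c \in val l.
Proof.
rewrite plucker_pointE; have [_] := vbasis_line l.
set b0 := _`_0; set b1 := _`_1 => ->.
by rewrite memvB ?memvZ ?memv_span // !inE eqxx ?orbT.
Qed.

(** As b0 and b1 are independent, some c takes the values b on b0 and -a on b1, and [plucker_pointE]
    then gives a b0 + b b1. *)
Lemma plucker_point_surj l v : v \in val l -> exists c, v = plucker_point l c.
Proof.
have [freeb Eb] := vbasis_line l.
rewrite {1}Eb span_cons span_seq1 => /memv_addP[_ /vlineP[a ->] [_ /vlineP[b ->] ->]].
set b0 := _`_0; set b1 := _`_1.
pose B : 'M[K]_(2, 4) := \matrix_(i, j) (if i == 0 then b0 0 j else b1 0 j).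
have freeB : row_free B.
  apply: inj_row_free => x E; apply/rowP => i.
  rewrite [RHS]mxE; move/(@freeP _ _ _ [tuple b0; b1]): freeb => /(_ (fun i => x 0 i)); apply.
  rewrite -[RHS]E; apply/rowP => j; rewrite summxE mxE; apply: eq_bigr => k _.
  by rewrite !mxE; case: k => -[|[|//]] Hk.
have /row_fullP[C EC] : row_full B^T by rewrite /row_full mxrank_tr.
pose w : 'rV[K]_2 := \row_i (if i == 0 then b else - a).
have Ew : (w *m C) *m B^T = w by rewrite -mulmxA EC mulmx1.
have Ew' k : \sum_(p < 4) (w *m C) 0 p * B k p = w 0 k.
  by rewrite -{2}Ew mxE; apply: eq_bigr => p _; rewrite [B^T _ _]mxE.
exists (w *m C); rewrite plucker_pointE -/b0 -/b1.
have -> : \sum_(p < 4) (w *m C) 0 p * b0 0 p = b.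
  by have := Ew' 0; rewrite [w 0 0]mxE /= => <-; apply: eq_bigr => p _; rewrite [B _ _]mxE.
have -> : \sum_(p < 4) (w *m C) 0 p * b1 0 p = - a.
  by have := Ew' 1; rewrite [w 0 1]mxE /= => <-; apply: eq_bigr => p _; rewrite [B _ _]mxE.
by rewrite scaleNr opprK addrC.
Qed.

End PluckerSpan.

Lemma coef_affine (S : nzRingType) (u v : S) i :
  (u%:P + v%:P * 'X)`_i = if i is 0%N then u else if i is 1%N then v else 0.
Proof.
rewrite coefD coefMX !coefC.
by case: i => [|[|i]] /=; rewrite ?addr0 ?add0r.
Qed.

(** Rows are added greedily: a nonzero u killed by the rows chosen so far is not killed by all rows,
    and one that does not kill it is independent of them. *)
Lemma row_free_extract (K : fieldType) N (I : Type) (R : I -> 'rV[K]_N) :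
  (forall u : 'cV[K]_N, (forall i, R i *m u = 0) -> u = 0) ->
  exists r : 'I_N -> I, \det (\matrix_(a < N) R (r a)) != 0.
Proof.
move=> H.
have [r Hr] : exists r : 'I_N -> I, row_free (\matrix_(a < N) R (r a)).
  suff E n : (n <= N)%N -> exists r : 'I_n -> I, row_free (\matrix_(a < n) R (r a)) by exact: E.
  elim: n => [|n IH] ltnN.
    by exists (fun i : 'I_0 => False_rect I (notF (ltn_ord i))); rewrite /row_free -leqn0 rank_leq_row.
  have [r Hr] := IH (ltnW ltnN); set B := \matrix_(a < n) R (r a) in Hr.
  have /rowV0Pn[u /sub_kermxP uB u0] : kermx B^T != 0.
    by rewrite -mxrank_eq0 mxrank_ker mxrank_tr (eqP Hr) subn_eq0 -ltnNge.
  have {uB} Bu : B *m u^T = 0 by apply: trmx_inj; rewrite trmx_mul trmxK uB trmx0.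
  have [i Ri] : exists i, R i *m u^T != 0.
    apply: contrapT => Hi; case/eqP: u0; apply: trmx_inj; rewrite trmx0; apply: H => i.
    by apply/eqP; apply: contrapT => /negP Ri; apply: Hi; exists i.
  exists (fun a => match unlift ord_max a with Some a' => r a' | None => i end).
  apply: inj_row_free => x.
  pose x' : 'rV[K]_n := \row_a x 0 (lift ord_max a).
  rewrite mulmx_sum_row big_ord_recr /= rowK unlift_none => E.
  have E1 : x' *m B + x 0 ord_max *: R i = 0.
    rewrite -[RHS]E mulmx_sum_row; congr (_ + _); apply: eq_bigr => a _.
    rewrite !rowK mxE (_ : widen_ord _ a = lift ord_max a) ?liftK //.
    by apply: val_inj; rewrite /= /bump leqNgt ltn_ord.
  have xm : x 0 ord_max = 0.
    have := congr1 (mulmx^~ u^T) E1.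
    rewrite mul0mx mulmxDl -mulmxA Bu mulmx0 add0r -scalemxAl => /eqP.
    by rewrite scaler_eq0 (negPf Ri) orbF => /eqP.
  move: E1; rewrite xm scale0r addr0 => /eqP; rewrite mulmx_free_eq0 // => /eqP x'0.
  apply/rowP => a; rewrite [RHS]mxE; case: (unliftP ord_max a) => [a' ->|->//].
  by have := congr1 (fun y : 'rV_n => y 0 a') x'0; rewrite !mxE.
exists r; rewrite -unitfE -[_ \is a _]/(_ \in unitmx) -row_free_unit //.
Qed.

Section BlockDegree.
Variables (K : fieldType) (s : nat).

Definition block_degree (k : 'I_s) (m : 'X_{1..s * 6}) : nat :=
  (\sum_(j < 6) m (mxvec_index k j))%N.

Lemma block_degree0 k : block_degree k 0%MM = 0%N.
Proof. by rewrite /block_degree big1 // => j _; rewrite mnm0E. Qed.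

Lemma block_degreeD k : {morph block_degree k : m1 m2 / (m1 + m2)%MM >-> (m1 + m2)%N}.
Proof.
by move=> m1 m2; rewrite /block_degree -big_split; apply: eq_bigr => j _; rewrite mnmDE.
Qed.

HB.instance Definition _ k :=
  isMeasure.Build (s * 6) (block_degree k) (block_degree0 k) (block_degreeD k).

Lemma block_degreeU k k' j : block_degree k U_(mxvec_index k' j) = (k' == k).
Proof.
rewrite /block_degree.
have E j' : U_(mxvec_index k' j)%MM (mxvec_index k j') = (k' == k) && (j == j').
  by rewrite mnm1E (inj_eq (@cast_ord_inj _ _ _)) (inj_eq enum_rank_inj).
under eq_bigr do rewrite E.
case: eqP => [_|_] /=; last by rewrite big1.
by rewrite (bigD1 j) //= eqxx big1 // => j' /negPf; rewrite eq_sym => ->.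
Qed.

Lemma multihomogeneousP (f : {mpoly K[s * 6]}) :
  multihomogeneous f <-> exists d, forall k, f \is (d k).-homog for (block_degree k).
Proof.
split=> -[d H]; exists d.
  by move=> k; apply/dhomogP => m mf; apply: H.
by move=> m mf k; move/dhomogP: (H k) => /(_ m mf).
Qed.

(* p becomes homogeneous of degree w * D once its variable is given degree w. *)
Definition codegree_homog (k : 'I_s) (w D : nat) (p : {poly {mpoly K[s * 6]}}) : Prop :=
  (forall i, (i <= D)%N -> p`_i \is (w * (D - i)).-homog for (block_degree k)) /\
  (forall i, (D < i)%N -> p`_i = 0).

Lemma codegree_homog1 k w : codegree_homog k w 0 1.
Proof.
split=> [i|i i0]; last by rewrite coef1 eqn0Ngt i0.
by rewrite leqn0 => /eqP ->; rewrite muln0 coef1 dhomog1.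
Qed.

Lemma codegree_homogM k w D D' p p' : codegree_homog k w D p -> codegree_homog k w D' p' ->
  codegree_homog k w (D + D') (p * p').
Proof.
move=> [Hp Hp0] [Hp' Hp'0]; split=> i Hi; rewrite coefM; last first.
  apply: big1 => j _; case: (leqP j D) => jD; last by rewrite Hp0 // mul0r.
  by rewrite Hp'0 ?mulr0 //; have := ltn_ord j; lia.
apply: rpred_sum => j _; case: (leqP j D) => jD; last by rewrite Hp0 // mul0r rpred0.
case: (leqP (i - j) D') => jD'; last by rewrite Hp'0 // mulr0 rpred0.
have -> : (w * (D + D' - i) = w * (D - j) + w * (D' - (i - j)))%N.
  by rewrite -mulnDr; congr (_ * _)%N; have := ltn_ord j; lia.
by apply: dhomogM; [apply: Hp|apply: Hp'].
Qed.

Lemma codegree_homog_mmap1 k w (h : 'I_4 -> {poly {mpoly K[s * 6]}}) (m : 'X_{1..4}) :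
  (forall i, codegree_homog k w 1 (h i)) -> codegree_homog k w (mdeg m) (mmap1 h m).
Proof.
move=> H; rewrite mdegE /mmap1; elim/big_rec2: _ => [|i d p _ Hd].
  exact: codegree_homog1.
apply: codegree_homogM => //; elim: (m i) => [|e IH]; first exact: codegree_homog1.
by rewrite exprS -add1n; apply: codegree_homogM.
Qed.

Definition block_coord (k : 'I_s) (j : 'I_6) : {mpoly K[s * 6]} := 'X_(mxvec_index k j).

(** The generic counterpart of [along]: the point of the k-th line carries Pluecker variables, and
    the direction q is constant. *)
Definition generic_along (k : 'I_s) (c q : 'rV[K]_4) (i : 'I_4) : {poly {mpoly K[s * 6]}} :=
  (skew_row (fun p => (c 0 p)%:MP) (block_coord k) i)%:P + ((q 0 i)%:MP)%:P * 'X.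

Lemma codegree_homog_generic_along k k' c q i :
  codegree_homog k (k' == k) 1 (generic_along k' c q i).
Proof.
rewrite /generic_along; set W := skew_row _ _ _; set Q := (q 0 i)%:MP.
have HW : W \is (k' == k).-homog for (block_degree k).
  apply: rpred_sum => p _; rewrite mul_mpolyC; apply: rpredZ; apply: rpred_sum => j _.
  have X1 : block_coord k' j \is (k' == k).-homog for (block_degree k).
    by rewrite dhomogX /= block_degreeU.
  by do 2!case: (_ == _); rewrite ?subr0 ?subrr ?sub0r ?mulr1 ?mulr0 ?mulrN1 ?rpredN ?rpred0.
have HQ : Q \is 0.-homog for (block_degree k).
  by rewrite /Q -[_%:MP]mulr1 mul_mpolyC; apply: rpredZ; apply: dhomog1.
move: W Q HW HQ => W Q HW HQ.
have Ec := coef_affine W Q.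
move: (W%:P + _) Ec => p Ec; split=> j; rewrite Ec; case: j => [|[|j]] Hj.
- by rewrite subn0 muln1.
- by rewrite subnn muln0.
- by rewrite ltnS ltn0 in Hj.
- by rewrite ltn0 in Hj.
- by rewrite ltnn in Hj.
- by [].
Qed.

Definition generic_coef (x : 'I_s * 'rV[K]_4 * 'rV[K]_4 * nat) (m : 'X_{1..4}) :
  {mpoly K[s * 6]} :=
  let: (k, c, q, j) := x in (mmap1 (generic_along k c q) m)`_j.

Lemma generic_coef_homog t k x m : mdeg m = t ->
  generic_coef x m \is ((x.1.1.1 == k) * (t - x.2)).-homog for (block_degree k).
Proof.
move=> Em; case: x => [[[k' c] q] j] /=.
have := codegree_homog_mmap1 m (codegree_homog_generic_along k k' c q); rewrite Em.
by case=> H H0; case: (leqP j t) => [/H //|/H0 ->]; rewrite rpred0.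
Qed.

Lemma plucker_eval_generic_coef x m (L : 'I_s -> line K) :
  plucker_eval (generic_coef x m) L =
  (along (plucker_point (L x.1.1.1) x.1.1.2) x.1.2 'X_[m])`_x.2.
Proof.
case: x => [[[k c] q] j]; rewrite /plucker_eval /=.
set e := meval _; rewrite -[LHS](coef_map e); congr ((polyseq _)`_j).
rewrite -(mmapX _ (polyC \o mpolyC (s * 6) (R := K))) rmorph_mmap.
apply: eq_mmap => [a|i] /=; first by rewrite map_polyC /= mevalC.
rewrite /generic_along rmorphD rmorphM /= map_polyX !map_polyC /= mevalC; congr (_%:P + _).
rewrite skew_row_morph mxE; congr skew_row.
  by apply/funext => p /=; rewrite mevalC.
by apply/funext => p /=; rewrite /block_coord mevalXU mxvecE mxE.
Qed.

Lemma dhomog_prod_ord n (mf : measure n) N (d : 'I_N -> nat) (F : 'I_N -> {mpoly K[n]}) :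
  (forall i, F i \is (d i).-homog for mf) ->
  \prod_(i < N) F i \is (\sum_(i < N) d i)%N.-homog for mf.
Proof.
by move=> H; elim/big_rec2: _ => [|i e p _ He]; [apply: dhomog1|apply: dhomogM].
Qed.

End BlockDegree.

Section Semicontinuity.
Variables (K : fieldType) (s : nat).
Hypothesis charK : [pchar K] =i pred0.
Implicit Types (L : 'I_s -> line K) (f : {mpoly K[4]}) (t m : nat).

Definition no_form L m t : Prop := forall f,
  symbolic_power (lines_ideal L) m f -> f \is t.-homog -> f = 0.

(** Vanishing to order m is a linear system on the coefficients of a form of degree t, with one row
    for each line, point, direction and order below m. At L0 its kernel is zero, so some maximal
    minor is nonzero; this minor, a polynomial in Pluecker coordinates, defines Z. *)
Lemma no_form_open L0 m t : no_form L0 m t ->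
  exists Z : set ('I_s -> line K), [/\ zariski_closed Z, Z <> setT &
    forall L, ~ Z L -> no_form L m t].
Proof.
move=> noL0.
pose B := [pred e : 'X_{1..4 < t.+1} | mdeg e == t].
pose N := #|B|; pose al (a : 'I_N) : 'X_{1..4} := enum_val a.
have al_deg a : mdeg (al a) = t by apply/eqP; have := enum_valP a.
have fE f : f \is t.-homog -> f = \sum_(a < N) f@_(al a) *: 'X_[al a].
  move=> ft; have sf : (msize f <= t.+1)%N.
    by rewrite mmeasureE; apply/bigmax_leqP_seq => e ef _; move/dhomogP: ft => /(_ e ef) /= ->.
  rewrite {1}(mpolywE sf) (bigID B) /= [X in _ + X]big1 => [|e Be]; last first.
    by rewrite (dhomog_nemf_coeff ft) ?scale0r.
  by rewrite addr0 big_enum_val.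
pose row L (x : 'I_s * 'rV[K]_4 * 'rV[K]_4 * 'I_m) : 'rV[K]_N :=
  \row_a (along (plucker_point (L x.1.1.1) x.1.1.2) x.1.2 'X_[al a])`_x.2.
have rowE L x (u : 'cV[K]_N) : (row L x *m u) 0 0 =
    (along (plucker_point (L x.1.1.1) x.1.1.2) x.1.2 (\sum_a u a 0 *: 'X_[al a]))`_x.2.
  rewrite rmorph_sum coef_sum mxE; apply: eq_bigr => a _.
  by rewrite mxE -mul_mpolyC rmorphM /= [along _ _ _%:MP]mmapC coefCM mulrC.
have kerE L f : f \is t.-homog -> (forall k, ideal_pow (line_ideal (L k)) m f) <->
    forall x, row L x *m (\col_a f@_(al a)) = 0.
  move=> ft; have Ef : \sum_a (\col_a f@_(al a)) a 0 *: 'X_[al a] = f.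
    by rewrite [RHS]fE //; apply: eq_bigr => a _; rewrite mxE.
  split=> [H x|H k].
    rewrite [LHS]mx11_scalar rowE Ef.
    have /pow_dvdXP -> := (line_ideal_powP charK _ _ _).1 (H x.1.1.1) _ x.1.2
      (plucker_point_mem (L x.1.1.1) x.1.1.2); by rewrite ?raddf0.
  apply/(line_ideal_powP charK) => v q /plucker_point_surj[c ->]; apply/pow_dvdXP => j jm.
  by have := congr1 (fun M : 'M_1 => M 0 0) (H (k, c, q, Ordinal jm)); rewrite rowE Ef mxE.
have [r Hr] : exists r : 'I_N -> _, \det (\matrix_(a < N) row L0 (r a)) != 0.
  apply: row_free_extract => u Hu.
  pose f := \sum_a u a 0 *: 'X_[al a] : {mpoly K[4]}.
  have ft : f \is t.-homog.
    by apply: rpred_sum => a _; apply: rpredZ; rewrite dhomogX /= al_deg.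
  have fu a : f@_(al a) = u a 0.
    rewrite raddf_sum /= (bigD1 a) //= mcoeffZ mcoeffX eqxx mulr1 big1 ?addr0 // => b ba.
    rewrite mcoeffZ mcoeffX; case: eqP => [/val_inj/enum_val_inj E|_]; last by rewrite mulr0.
    by rewrite E eqxx in ba.
  have Ecol : \col_a f@_(al a) = u by apply/colP => a; rewrite mxE fu.
  suff f0 : f = 0 by apply/colP => a; rewrite -fu f0 mcoeff0 mxE.
  apply: noL0 => //; apply/(symbolic_powerP _ charK)/(kerE _ _ ft) => x.
  by rewrite Ecol.
pose x a : 'I_s * 'rV[K]_4 * 'rV[K]_4 * nat := let: (k, c, q, j) := r a in (k, c, q, val j).
pose F : {mpoly K[s * 6]} := \det (\matrix_(a, b) generic_coef (x a) (al b)).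
have evF L : plucker_eval F L = \det (\matrix_(a < N) row L (r a)).
  rewrite /plucker_eval /F -[LHS]det_map_mx; congr (\det _).
  apply/matrixP => a b; rewrite !mxE -[LHS]/(plucker_eval _ L) plucker_eval_generic_coef.
  by rewrite /x; case: (r a) => [[[k c] q] j].
(* Along a row the block degrees are the same in all columns, so all terms of the determinant share
   them. *)
have multF : multihomogeneous F.
  apply/multihomogeneousP; exists (fun k => \sum_(a < N) ((x a).1.1.1 == k) * (t - (x a).2))%N => k.
  apply: rpred_sum => sg _; rewrite rpredMsign; apply: dhomog_prod_ord => a.
  by rewrite mxE; apply: generic_coef_homog.
exists [set L | plucker_eval F L = 0]; split.
- by exists [set F]; split=> [_ ->//|]; apply/seteqP; split=> L /= H; [move=> _ ->|apply: H].
- by move=> /seteqP[_ /(_ L0 I)] /=; rewrite evF; apply/eqP.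
- move=> L /= ZL f /(symbolic_powerP _ charK) If ft.
  have H := (kerE L f ft).1 If.
  have M0 : (\matrix_(a < N) row L (r a)) *m (\col_a f@_(al a)) = 0.
    by apply/row_matrixP => a; rewrite row_mul rowK H row0.
  have uM : \matrix_(a < N) row L (r a) \in unitmx.
    by rewrite unitmxE unitfE -evF; apply/eqP.
  have c0 : \col_a f@_(al a) = 0 by rewrite -(mulKmx uM (\col_a _)) M0 mulmx0.
  rewrite (fE f ft) big1 // => a _.
  by have := congr1 (fun M : 'cV_N => M a 0) c0; rewrite !mxE => ->; rewrite scale0r.
Qed.

End Semicontinuity.

(** * Countable unions of proper closed sets *)

Definition update (I : eqType) (S : Type) (y : I -> S) (i : I) (c : S) : I -> S :=
  fun j => if j == i then c else y j.

Lemma countable_poly_roots (K : closedFieldType) (p : {poly K}) :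
  p != 0 -> countable [set c | p.[c] = 0].
Proof.
move=> p0; have [r E] := closed_field_poly_normal p.
apply: (@sub_countable _ _ _ [set` r]); last exact: finite_set_countable.
apply: subset_card_le => c /= pc; rewrite -root_prod_XsubC.
have : root p c by apply/rootP.
by rewrite E rootZ // lead_coef_eq0.
Qed.

(* The coordinates of y are chosen one after the other, each of them outside the
   roots of countably many nonzero univariate polynomials. *)
Lemma common_nonroot (K : closedFieldType) (I : finType) (H : nat -> (I -> K) -> K)
    (ys : nat -> I -> K) : ~ countable [set: K] ->
  (forall n y i, exists p : {poly K}, forall c, H n (update y i c) = p.[c]) ->
  (forall n, H n (ys n) != 0) -> exists y, forall n, H n y != 0.
Proof.
move=> uncK polyH Hys.
(* Coordinates in l are already common to all n; the others still come from the witness for n. *)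
suff /(_ (enum I))[y Hy] (l : seq I) : exists y, forall n,
    H n (fun j => if j \in l then y j else ys n j) != 0.
  exists y => n; move: (Hy n); congr (H n _ != 0).
  by apply/funext => j; rewrite mem_enum.
elim: l => [|i l [y Hy]]; first by exists (ys 0%N).
pose z n j := if j \in l then y j else ys n j.
have /choice[p Hp] n : exists p : {poly K}, forall c, H n (update (z n) i c) = p.[c].
  exact: polyH.
have p0 n : p n != 0.
  apply: contra_neq (Hy n) => E; have := Hp n (z n i); rewrite E horner0 => <-.
  by congr (H n _); apply/funext => j; rewrite /update; case: eqP => [->|].
(* Otherwise K would be a countable union of countable sets of roots. *)
have [c Hc] : exists c, forall n, (p n).[c] != 0.
  apply: contrapT => Hc; apply: uncK.
  apply: (@sub_countable _ _ _ (\bigcup_n [set c | (p n).[c] = 0])); last first.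
    by apply: bigcup_countable => // n _; apply: countable_poly_roots.
  apply: subset_card_le => c _; apply: contrapT => Hn; apply: Hc; exists c => n.
  by apply/eqP => E; apply: Hn; exists n.
exists (update y i c) => n; have := Hc n; rewrite -Hp; congr (H n _ != 0).
apply/funext => j; rewrite /update inE /z.
by case: eqP.
Qed.

Section PluckerAvoidance.
Variable s : nat.

(** Pluecker coordinates of lines through pairs of points: this parametrizes by an affine space,
    where coordinates can be chosen one at a time. *)
Definition minors (S : comNzRingType) (B : 'I_s * 'I_2 * 'I_4 -> S) (k : 'I_s) (j : 'I_6) : S :=
  B (k, 0, (plucker_pair j).1) * B (k, 1, (plucker_pair j).2)
  - B (k, 0, (plucker_pair j).2) * B (k, 1, (plucker_pair j).1).

Definition multi_point (S : comNzRingType) (x : 'I_s -> 'I_6 -> S) (i : 'I_(s * 6)) : S :=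
  mxvec (\matrix_(k, j) x k j) 0 i.

Variable K : closedFieldType.
Implicit Types (L : 'I_s -> line K) (F : {mpoly K[s * 6]}).

Lemma plucker_evalE F L : plucker_eval F L = F.@[multi_point (fun k => plucker (L k) 0)].
Proof. by []. Qed.

Lemma multi_point_index (S : comNzRingType) (x : 'I_s -> 'I_6 -> S) k j :
  multi_point x (mxvec_index k j) = x k j.
Proof. by rewrite /multi_point mxvecE mxE. Qed.

Lemma multihomogeneous_scale F (lam : 'I_s -> K) (x : 'I_s -> 'I_6 -> K) :
  multihomogeneous F -> exists d : 'I_s -> nat,
  F.@[multi_point (fun k j => lam k * x k j)] = (\prod_k lam k ^+ d k) * F.@[multi_point x].
Proof.
move=> [d Hd]; exists d; rewrite !mevalE mulr_sumr big_seq [RHS]big_seq.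
apply: eq_bigr => m mF; rewrite [RHS]mulrCA; congr (_ * _).
have E (y : 'I_s -> 'I_6 -> K) : \prod_i multi_point y i ^+ m i =
    \prod_k \prod_j y k j ^+ m (mxvec_index k j).
  rewrite (reindex _ (curry_mxvec_bij _ _)) /= pair_bigA; apply: eq_bigr => -[k j] _ /=.
  by rewrite multi_point_index.
rewrite !E -big_split; apply: eq_bigr => k _ /=.
rewrite -(Hd m mF k) -prodrXr -big_split; apply: eq_bigr => j _ /=.
by rewrite exprMn.
Qed.

Lemma minors_update (B : 'I_s * 'I_2 * 'I_4 -> K) i c k j :
  minors (update B i c) k j = (minors (update (polyC \o B) i 'X) k j).[c].
Proof.
have E x : update B i c x = (update (polyC \o B) i 'X x).[c].
  by rewrite /update; case: eqP; rewrite ?hornerX ?hornerC.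
by rewrite /minors !E !hornerE.
Qed.

(** A nonzero first minor makes the rows of B independent; lam is the determinant that expresses
    them in the chosen basis of their span. *)
Lemma line_of_minors (B : 'I_2 -> 'I_4 -> K) (x : 'I_6 -> K) :
  (forall j, x j = B 0 (plucker_pair j).1 * B 1 (plucker_pair j).2
                 - B 0 (plucker_pair j).2 * B 1 (plucker_pair j).1) ->
  x 0 != 0 -> exists (l : line K) lam, forall j, x j = lam * plucker l 0 j.
Proof.
move=> Hx x0; pose r i : 'rV[K]_4 := \row_q B i q.
have dimV : \dim <<[:: r 0; r 1]>> == 2%N.
  suff : free [:: r 0; r 1] by [].
  apply/(@freeP _ _ _ [tuple r 0; r 1]) => k.
  rewrite !big_ord_recl big_ord0 addr0 /= => E.
  have Eq q : k ord0 * B 0 q + k (lift ord0 ord0) * B 1 q = 0.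
    by have := congr1 (fun M : 'rV_4 => M 0 q) E; rewrite !mxE.
  set p1 := (plucker_pair 0).1; set p2 := (plucker_pair 0).2.
  have k0 : k ord0 = 0.
    apply: (mulIf x0); rewrite mul0r Hx -/p1 -/p2.
    rewrite (_ : _ * _ = (k ord0 * B 0 p1 + k (lift ord0 ord0) * B 1 p1) * B 1 p2
       - (k ord0 * B 0 p2 + k (lift ord0 ord0) * B 1 p2) * B 1 p1); last by ring.
    by rewrite !Eq !mul0r subrr.
  have k1 : k (lift ord0 ord0) = 0.
    apply: (mulIf x0); rewrite mul0r Hx -/p1 -/p2.
    rewrite (_ : _ * _ = (k ord0 * B 0 p2 + k (lift ord0 ord0) * B 1 p2) * B 0 p1
       - (k ord0 * B 0 p1 + k (lift ord0 ord0) * B 1 p1) * B 0 p2); last by ring.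
    by rewrite !Eq !mul0r subrr.
  by case=> -[|[|//]] Hi; [rewrite -[RHS]k0|rewrite -[RHS]k1]; congr k; apply: val_inj.
pose l : line K := exist (fun V : {vspace 'rV[K]_4} => \dim V == 2%N) _ dimV.
exists l; have [_] := vbasis_line l; set b0 := _`_0; set b1 := _`_1 => El.
have rl i : r i \in val l.
  by case: i => -[|[|//]] Hi; apply: memv_span; rewrite !inE; apply/orP;
    [left|right]; apply/eqP; congr r; apply: val_inj.
have rE i : exists a b, r i = a *: b0 + b *: b1.
  have := rl i; rewrite {1}El span_cons span_seq1.
  by move=> /memv_addP[_ /vlineP[a ->] [_ /vlineP[b ->] ->]]; exists a, b.
have [a0 [c0 E0]] := rE 0; have [a1 [c1 E1]] := rE 1.
exists (a0 * c1 - a1 * c0) => j; rewrite Hx mxE -/b0 -/b1.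
have B0 q : B 0 q = a0 * b0 0 q + c0 * b1 0 q.
  by have := congr1 (fun M : 'rV_4 => M 0 q) E0; rewrite !mxE.
have B1 q : B 1 q = a1 * b0 0 q + c1 * b1 0 q.
  by have := congr1 (fun M : 'rV_4 => M 0 q) E1; rewrite !mxE.
by case: (plucker_pair j) => p q /=; rewrite !B0 !B1; ring.
Qed.

Lemma zariski_avoid (Z : nat -> set ('I_s -> line K)) : ~ countable [set: K] ->
  (forall n, zariski_closed (Z n) /\ Z n <> setT) -> exists L, ~ (\bigcup_n Z n) L.
Proof.
move=> uncK HZ.
(* Each proper closed set lies in a hypersurface F = 0 that is still proper. *)
have /choice[F HF] n : exists F, [/\ multihomogeneous F,
    forall L, Z n L -> plucker_eval F L = 0 & exists L, plucker_eval F L != 0].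
  have [[FF [multF EZ]] NT] := HZ n.
  have [L ZL] : exists L, ~ Z n L.
    by apply: contrapT => H; apply: NT; apply/seteqP; split=> // L _;
       apply: contrapT => ZL; apply: H; exists L.
  have [F FF1 FL] : exists2 F, FF F & plucker_eval F L != 0.
    apply: contrapT => H; apply: ZL; rewrite EZ /= => F FFF; apply/eqP; apply: contrapT => /negP FL.
    by apply: H; exists F.
  by exists F; split; [apply: multF|move=> L'; rewrite EZ; apply|exists L].
have /choice[L0 HL0] n : exists L, plucker_eval (F n) L != 0 by case: (HF n).
(* H 0 forces the two rows of every block of B to be linearly independent. *)
pose H n (B : 'I_s * 'I_2 * 'I_4 -> K) : K := if n is n'.+1
  then (F n').@[multi_point (minors B)] else \prod_k minors B k 0.
(* For n = 0 the two rows are the first two unit vectors; afterwards they are bases of lines on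
   which the polynomial does not vanish. *)
pose ys n (x : 'I_s * 'I_2 * 'I_4) : K := if n is n'.+1
  then (vbasis (val (L0 n' x.1.1)))`_(val x.1.2) 0 x.2 else (val x.1.2 == val x.2)%:R.
have [||B HB] := @common_nonroot K _ H ys uncK.
- move=> [|n] y i.
    exists (\prod_k minors (update (polyC \o y) i 'X) k 0) => c.
    by rewrite horner_prod; apply: eq_bigr => k _; rewrite minors_update.
  exists (mmap polyC (multi_point (minors (update (polyC \o y) i 'X))) (F n)) => c.
  rewrite -[RHS]/(horner_eval c _) rmorph_mmap; apply: eq_mmap => [a|x] /=.
    by rewrite /horner_eval hornerC.
  by case/mxvec_indexP: x => k j; rewrite !multi_point_index minors_update.
- move=> [|n].
    apply/prodf_neq0 => k _; rewrite /minors /ys /plucker_pair /= !inordK //=.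
    by rewrite mulr1 mulr0 subr0 oner_neq0.
  move: (HL0 n); rewrite plucker_evalE; congr (_ != 0); apply: meval_eq => x.
  case/mxvec_indexP: x => k j; rewrite !multi_point_index mxE.
  by rewrite /minors /ys; case: (plucker_pair j).
have /choice[l /choice[lam Hl]] k : exists (l : line K) lam,
    forall j, minors B k j = lam * plucker l 0 j.
  apply: (@line_of_minors (fun i q => B (k, i, q))) => //.
  have := HB 0%N; rewrite /H; apply: contra_neq => E.
  by rewrite (bigD1 k) //= E mul0r.
exists l => -[n _ Zl]; have [multF FZ _] := HF n.
have [d E] := multihomogeneous_scale lam (fun k => plucker (l k) 0) multF.
have := HB n.+1; rewrite /H; apply/negP; rewrite negbK; apply/eqP.
transitivity ((F n).@[multi_point (fun k j => lam k * plucker (l k) 0 j)]).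
  by apply: meval_eq => x; case/mxvec_indexP: x => k j; rewrite !multi_point_index Hl.
by rewrite E -plucker_evalE FZ // mulr0.
Qed.

End PluckerAvoidance.

(** * Initial degrees and Waldschmidt constants *)

Section Fekete.
Variable R : realType.
Variable u : nat -> nat.
Hypothesis u_subadd : forall m n, (u (m + n) <= u m + u n)%N.

Lemma subadditive_quotient M q r : (u (q * M + r) <= q * u M + (u 0 + r * u 1))%N.
Proof.
have H0 : (u r <= u 0 + r * u 1)%N.
  elim: r => [|r IH]; first by rewrite mul0n addn0.
  by rewrite -addn1; apply: leq_trans (u_subadd _ _) _; lia.
elim: q => [|q IH]; first by rewrite !mul0n !add0n.
by rewrite mulSn -addnA; apply: leq_trans (u_subadd _ _) _; lia.
Qed.

(** Fekete's lemma: the quotients converge to their infimum over n >= 1. *)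
Lemma subadditive_is_cvg : cvgn (fun n => (u n)%:R / n%:R : R).
Proof.
pose E : set R := [set x | exists n, x = (u n.+1)%:R / n.+1%:R].
have E0 : E !=set0 by exists ((u 1)%:R / 1%:R), 0%N.
have lbE : lbound E 0 by move=> _ [n ->]; rewrite divr_ge0.
have hasE : has_inf E by split=> //; exists 0.
apply/cvg_ex; exists (inf E); apply/cvgrPdist_lt => e e0.
have [_ [M' ->] HM] := inf_adherent (divr_gt0 e0 (ltr0n R 2)) hasE.
(* C bounds the contribution of the remainder modulo M, uniformly in n. *)
set M := M'.+1 in HM; pose C : R := (u 0 + M * u 1)%:R.
have C0 : 0 <= C by rewrite ler0n.
have [N HN] : exists N : nat, C / (e / 2) < N%:R.
  by exists (Num.truncn (C / (e / 2))).+1; apply: truncnS_gt.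
near=> n.
have n_gt0 : (0 < n)%N by near: n; exists 1%N.
have n_gtN : (N <= n)%N by near: n; exists N.
have nR : 0 < n%:R :> R by rewrite ltr0n.
have lo : inf E <= (u n)%:R / n%:R.
  by apply: ge_inf; [exists 0|exists n.-1; rewrite prednK].
rewrite distrC ger0_norm ?subr_ge0 //.
have hi : (u n)%:R <= n%:R * ((u M)%:R / M%:R) + C :> R.
  rewrite {1}(divn_eq n M); apply: (@le_trans _ _ ((n %/ M) * u M + (u 0 + (n %% M) * u 1))%:R).
    by rewrite ler_nat; apply: subadditive_quotient.
  rewrite natrD lerD //; last first.
    by rewrite ler_nat leq_add2l leq_mul2r ltnW ?orbT // ltn_mod.
  rewrite natrM mulrA mulrAC ler_wpM2r // ler_pdivlMr ?ltr0n // -natrM ler_nat.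
  exact: leq_trunc_div.
have hi' : (u n)%:R / n%:R <= (u M)%:R / M%:R + C / n%:R.
  rewrite ler_pdivrMr // mulrDl divfK ?gt_eqF //.
  by rewrite mulrC.
have Cn : C / n%:R < e / 2.
  rewrite ltr_pdivrMr // mulrC -ltr_pdivrMr ?divr_gt0 //.
  by apply: lt_le_trans HN _; rewrite ler_nat.
by rewrite ltrBlDr; apply: le_lt_trans hi' _; lra.
Unshelve. all: by end_near.
Qed.

End Fekete.

Section InitialDegree.
Variables (K : fieldType) (n : nat).
Implicit Types (I : set {mpoly K[n]}) (t : nat).

Definition has_form I t : Prop := exists f, [/\ I f, f != 0 & f \is t.-homog].

Lemma initial_degreeP I : (exists t, has_form I t) ->
  has_form I (initial_degree I) /\ forall t, has_form I t -> (initial_degree I <= t)%N.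
Proof.
move=> [t0 Ht0].
have ex : exists t, `[< has_form I t >] by exists t0; apply/asboolP.
case: (ex_minnP ex) => t /asboolP Ht min_t.
have min_t' u : has_form I u -> (t <= u)%N by move=> Hu; apply: min_t; apply/asboolP.
rewrite /initial_degree; set P := [set t | _].
by have [] : P (xget 0%N P) by apply: xgetPex; exists t.
Qed.

End InitialDegree.

Section InitialDegreeOfLines.
Variables (K : fieldType) (s : nat).
Hypothesis charK : [pchar K] =i pred0.
Implicit Types (L : 'I_s -> line K) (f : {mpoly K[4]}) (m t : nat).

Let alpha L m := initial_degree (symbolic_power (lines_ideal L) m).

Lemma symbolic_power_mul L m m' f f' :
  symbolic_power (lines_ideal L) m f -> symbolic_power (lines_ideal L) m' f' ->
  symbolic_power (lines_ideal L) (m + m') (f * f').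
Proof.
move=> /(symbolic_powerP _ charK) H /(symbolic_powerP _ charK) H'.
by apply/(symbolic_powerP _ charK) => k; apply: ideal_powM.
Qed.

(** Take the product of the m-th powers of linear forms, one vanishing on each line. Hence
    [initial_degree] is here a true minimum and not its default. *)
Lemma has_form_symbolic_power L m : has_form (symbolic_power (lines_ideal L) m) (s * m).
Proof.
have /choice[g Hg] k : exists g, [/\ line_ideal (L k) g, g \is 1.-homog & g != 0].
  have /subvPn[v _ /linear_form_off_line[g [Ig g1 gv]]] : ~~ (fullv <= val (L k))%VS.
    apply/negP => /dimvS; rewrite dimvf dim_matrix (eqP (valP (L k))) //.
  by exists g; split=> //; apply: contra_neq gv => ->; rewrite meval0.
exists (\prod_k g k ^+ m); split.
- apply/(symbolic_powerP _ charK) => k; rewrite (bigD1 k) //= mulrC; apply: ideal_genM.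
  by apply: ideal_powX; case: (Hg k).
- by apply/prodf_neq0 => k _; apply: expf_neq0; case: (Hg k).
- have -> : (s * m = \sum_(k < s) 1 * m)%N by rewrite sum_nat_const card_ord mul1n.
  by apply: dhomog_prod_ord => k; apply: dhomogMn; case: (Hg k).
Qed.

Lemma initial_degree_linesP L m :
  has_form (symbolic_power (lines_ideal L) m) (alpha L m) /\
  forall t, has_form (symbolic_power (lines_ideal L) m) t -> (alpha L m <= t)%N.
Proof. by apply: initial_degreeP; exists (s * m)%N; apply: has_form_symbolic_power. Qed.

Lemma initial_degree_subadditive L m m' : (alpha L (m + m') <= alpha L m + alpha L m')%N.
Proof.
have [[f [If f0 fd]] _] := initial_degree_linesP L m.
have [[f' [If' f'0 fd']] _] := initial_degree_linesP L m'.
apply: (initial_degree_linesP L (m + m')).2; exists (f * f'); split.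
- exact: symbolic_power_mul.
- exact: mulf_neq0.
- exact: dhomogM.
Qed.

(** A form of lower degree can be multiplied by a power of x_0 to reach degree t, so excluding
    degree t excludes all degrees below. *)
Lemma no_formP L m t : no_form L m t <-> (t < alpha L m)%N.
Proof.
have [[f [If f0 fd]] min_t] := initial_degree_linesP L m.
split=> [H|lt_t g Ig gt]; last first.
  apply/eqP; apply: contrapT => /negP g0; have : (alpha L m <= t)%N by apply: min_t; exists g.
  by rewrite leqNgt lt_t.
rewrite ltnNge; apply/negP => le_t.
have X0 : 'X_0 != 0 :> {mpoly K[4]} by rewrite -msupp_eq0 msuppX.
have : f * 'X_0 ^+ (t - alpha L m) = 0.
  apply: H.
    move: If => /(symbolic_powerP _ charK) If; apply/(symbolic_powerP _ charK) => k.
    by rewrite mulrC; apply: ideal_genM; apply: If.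
  rewrite -[t](subnKC le_t) addKn; apply: dhomogM => //.
  by rewrite -[X in X.-homog]mul1n; apply: dhomogMn; rewrite dhomogX /= mdeg1.
by move/eqP; rewrite mulf_eq0 expf_eq0 (negPf f0) (negPf X0) andbF.
Qed.

Lemma initial_degree_open L0 m t : (t <= alpha L0 m)%N ->
  exists Z : set ('I_s -> line K), [/\ zariski_closed Z, Z <> setT &
    forall L, ~ Z L -> (t <= alpha L m)%N].
Proof.
case: t => [_|t /no_formP/(no_form_open charK)[Z [cZ ZT HZ]]]; last first.
  by exists Z; split=> // L /HZ/no_formP.
(* For t = 0 nothing is excluded, and the constant 1 cuts out the empty set. *)
exists set0; split=> //.
- exists [set 1]; split=> [_ ->|].
    by exists (fun=> 0%N) => e; rewrite msupp1 inE => /eqP -> k; rewrite big1 // => j _; rewrite mnm0E.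
  apply/seteqP; split=> // L /(_ 1 erefl) /eqP.
  by rewrite /plucker_eval meval1 oner_eq0.
- by move=> /seteqP[_ /(_ L0 I)].
Qed.

(** Initial degrees are at most s m, so some configuration attains their maximum; by semicontinuity
    it is then attained outside a proper closed set. *)
Lemma generic_initial_degree m : exists T : nat,
  exists Z : set ('I_s -> line K), [/\ zariski_closed Z, Z <> setT &
    forall L, ~ Z L -> alpha L m = T].
Proof.
have [l _] := graph_line_exists 0 (1 : K).
have ex : exists t, `[< exists L, alpha L m = t >].
  by exists (alpha (fun=> l) m); apply/asboolP; exists (fun=> l).
have bd t : `[< exists L, alpha L m = t >] -> (t <= s * m)%N.
  move=> /asboolP[L <-]; apply: (initial_degree_linesP L m).2; exact: has_form_symbolic_power.
case: (ex_maxnP ex bd) => T /asboolP[L0 <-] maxT; exists (alpha L0 m).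
have [Z [cZ ZT HZ]] := initial_degree_open (leqnn (alpha L0 m)).
exists Z; split=> // L ZL; apply/eqP; rewrite eqn_leq HZ // andbT.
by apply: maxT; apply/asboolP; exists L.
Qed.

End InitialDegreeOfLines.

(** Alternating the two sequences gives one countable union, which some L avoids. *)
Lemma very_general_and (K : closedFieldType) (s : nat) (P Q : ('I_s -> line K) -> Prop) :
  ~ countable [set: K] -> very_general P -> very_general Q -> exists L, P L /\ Q L.
Proof.
move=> uncK [Z [HZ PZ]] [W [HW QW]].
have [n|L HL] := zariski_avoid (Z := fun n => if odd n then Z n./2 else W n./2) uncK.
  by case: odd.
exists L; split.
  apply: PZ => -[n _ Zn]; apply: HL; exists n.*2.+1 => //=.
  by rewrite odd_double /= uphalf_double.
apply: QW => -[n _ Wn]; apply: HL; exists n.*2 => //=.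
by rewrite odd_double doubleK.
Qed.

Theorem theorem2 (K : closedFieldType) (charK : [pchar K] =i pred0)
    (uncountableK : ~ countable [set: K]) (R : realType) (s : nat)
    (s_ge1 : (1 <= s)%N) :
  (Num.floor (Num.sqrt (2 * s%:R - 1 : R)))%:~R <= alpha_hat K R s.
Proof.
set x := Num.sqrt _.
have [k Ek] : exists k : nat, Num.floor x = k%:Z.
  by exists `|Num.floor x|%N; rewrite gez0_abs // floor_ge0 sqrtr_ge0.
(* Squaring k <= sqrt (2 s - 1) gives k^2 <= 2 s - 1. *)
have k2 : (k ^ 2 < 2 * s)%N.
  have s1 : 1 <= s%:R :> R by rewrite ler1n.
  have kx : k%:R <= x by have := floor_le x; rewrite Ek.
  rewrite -(ltr_nat R) natrX natrM.
  apply: (@le_lt_trans _ _ (x ^+ 2)); first by rewrite ler_pXn2r ?nnegrE ?sqrtr_ge0.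
  by rewrite sqr_sqrtr; lra.
rewrite Ek /alpha_hat; set A := [set a | _].
have /choice[T /choice[Z HZ]] m := generic_initial_degree s charK m.
(* Very general lines share all their initial degrees, hence the Waldschmidt constant, so
   [alpha_hat] has a common value to return. *)
have VT : very_general (fun L : 'I_s -> line K =>
    waldschmidt R (lines_ideal L) = limn (fun m => (T m)%:R / m%:R : R)).
  exists Z; split=> [m|L HL]; first by case: (HZ m).
  rewrite /waldschmidt; congr (limn _); apply/funext => m.
  by have [_ _ ->] := HZ m; last by move=> Zm; apply: HL; exists m.
have : A (xget 0 A) by apply: xgetPex; eexists; exact: VT.
have [L0 HL0] := special_lines charK k2.
have /choice[W HW] m : exists Z : set ('I_s -> line K), [/\ zariski_closed Z, Z <> setT &
    forall L, ~ Z L -> (k * m <= initial_degree (symbolic_power (lines_ideal L) m))%N].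
  apply: (initial_degree_open charK (L0 := L0)).
  have [[f [/(symbolic_powerP _ charK) If f0 fd]] _] := initial_degree_linesP charK L0 m.
  exact: HL0 fd If.
have VW : very_general (fun L : 'I_s -> line K =>
    forall m, (k * m <= initial_degree (symbolic_power (lines_ideal L) m))%N).
  exists W; split=> [m|L HL m]; first by case: (HW m).
  by have [_ _] := HW m; apply => Wm; apply: HL; exists m.
(* A single L realizes both the value returned by [alpha_hat] and the bounds k m on all initial
   degrees. *)
move=> /(very_general_and uncountableK)/(_ VW)[L [<- HL]].
apply: limr_ge.
  exact/subadditive_is_cvg/initial_degree_subadditive.
near=> m; have m0 : (0 < m)%N by near: m; exists 1%N.
by rewrite ler_pdivlMr ?ltr0n // -natrM ler_nat.
Unshelve. all: by end_near.
Qed.
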